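(* Let $N,n,c\ge 1$ be integers with $N=n+c$ and fix $a\in\mathbb{N}$. If $X\subseteq\mathbb{P}^N$ is a generic complete intersection of dimension $n$, codimension $c$ and multidegree $(d_1,\dots,d_c)$ satisfying $c\ge n$ and $d_i\ge\delta_{N,n,a+1}$ for all $i$, then $\Omega_X\otimes\mathcal{O}_X(-a)$ is ample modulo an algebraic subset of codimension at least two in $X$.
   Context: Everything is over $\mathbb{C}$. For a vector bundle $E$ on $X$, $\mathbb{P}(E)$ is the projective bundle of rank one quotients of $E$. ''Generic'' means that the tuple of defining equations of $X$ lies in a suitable nonempty Zariski open subset of $\mathbb{P}^{N_{d_1}}\times\cdots\times\mathbb{P}^{N_{d_c}}$, where $\mathbb{P}^{N_d}$ is the projective space of hypersurfaces of degree $d$ in $\mathbb{P}^N$; in particular $X$ is smooth. Ampleness modulo a subset: let $E$ be a vector bundle on a projective variety $X$, $H$ an ample line bundle on $X$, $\pi:\mathbb{P}(E)\to X$ the projection, $T\subset X$. $E$ is ample modulo $T$ (ample outside $T$) if for sufficiently small $\epsilon>0$ every irreducible curve $C\subset\mathbb{P}(E)$ with $\int_C c_1(\mathcal{O}_{\mathbb{P}(E)}(1))<\epsilon\, C\cdot\pi^*H$ satisfies $\pi(C)\subseteq T$. The constant: for $a\in\mathbb{N}$, $\delta_{N,n,a}$ denotes a positive integer (which exists) with the following property: if $X\subset\mathbb{P}^N$ is a generic complete intersection of dimension $n$, codimension $c\ge n$ and multidegree $(d_1,\dots,d_c)$ with $d_i\ge\delta_{N,n,a}$ for all $i$, then $\mathcal{O}_{\mathbb{P}(\Omega_X)}(1)\otimes\pi_{\Omega_X}^*\mathcal{O}_X(-a)$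 is big (with $\pi_{\Omega_X}:\mathbb{P}(\Omega_X)\to X$ the projection) and there is an algebraic subset $Y\subset X$ of codimension at least two containing the image under $\pi_{\Omega_X}$ of the stable base locus of $\mathcal{O}_{\mathbb{P}(\Omega_X)}(1)\otimes\pi_{\Omega_X}^*\mathcal{O}_X(-a)$ (the intersection of the base loci of all its positive powers). *)

(* Defs.v *)
From HB Require Import structures.
From mathcomp Require Import all_boot all_order all_algebra.
From mathcomp Require Import complex mpoly.
From mathcomp Require Import boolp classical_sets functions reals.

Set Implicit Arguments.
Unset Strict Implicit.
Unset Printing Implicit Defensive.

Import Order.TTheory GRing.Theory Num.Theory.

Local Open Scope classical_set_scope.
Local Open Scope ring_scope.
Local Open Scope complex_scope.

(* Complex algebraic varieties are treated classically, as spaces with        *)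
(* functions: a set of closed points, its Zariski open sets, and for every    *)
(* open set U the functions regular on U. A regular function is given as a    *)
(* total function of which only the values on U matter. Bundles are given by  *)
(* trivializing open sets and transition functions.                           *)

Section SpacesWithFunctions.
Context {R : realType}.
Local Notation C := R[i].

Record space := Space {
  pt :> Type;
  zopen : set (set pt);
  regular : set pt -> set (pt -> C) }.

Definition zclosed (Z : space) (A : set Z) : Prop := zopen (~` A).

(* For f the inclusion of a closed (or locally closed) subset, this is its    *)
(* structure of reduced subvariety.                                           *)
Definition induced (T : Type) (Z : space) (f : T -> Z) : space :=
  @Space T
    (fun U => exists W : set Z, zopen W /\ U = f @^-1` W)
    (fun U g => forall x, U x -> exists (W : set Z) (h : Z -> C),
       [/\ zopen W, W (f x), regular W h &
           forall y, U y -> W (f y) -> g y = h (f y)]).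

Definition subspace (Z : space) (A : set Z) : space :=
  induced (fun x : {x : Z | A x} => sval x).

Definition incl (Z : space) (A : set Z) : subspace A -> Z := fun x => sval x.

Definition closed_embedding (Y Z : space) (f : Y -> Z) : Prop :=
  [/\ injective f, zclosed (range f),
      (forall U : set Y, zopen U <-> zopen (U : set (induced f))) &
      forall (U : set Y) (g : Y -> C), zopen U ->
        regular U g <-> regular (U : set (induced f)) g].

Section Dimension.
Context {Z : space}.
Implicit Types A B Y : set Z.

Definition irreducible_closed A : Prop :=
  [/\ A !=set0, zclosed A &
      forall B1 B2, zclosed B1 -> zclosed B2 -> A `<=` B1 `|` B2 ->
        A `<=` B1 \/ A `<=` B2].

(* W 0, ..., W k is a strictly increasing chain of irreducible closed sets.   *)
Definition irreducible_chain (k : nat) (W : nat -> set Z) : Prop :=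
  (forall i, (i <= k)%N -> irreducible_closed (W i)) /\
  (forall i, (i < k)%N -> W i `<` W i.+1).

Definition has_chain A (k : nat) : Prop :=
  exists W, irreducible_chain k W /\ W k `<=` A.

Definition has_dim A (k : nat) : Prop := has_chain A k /\ ~ has_chain A k.+1.

(* The codimension of the empty set is infinite. *)
Definition codim_ge Y (k : nat) : Prop :=
  forall A, irreducible_closed A -> A `<=` Y ->
    exists W, irreducible_chain k W /\ W 0%N = A.

Definition irreducible_curve A : Prop := irreducible_closed A /\ has_dim A 1.

End Dimension.

Section LocalRing.
Context {Z : space}.
Implicit Types (p : Z) (f g : Z -> C).

Definition regular_at p f : Prop :=
  exists U : set Z, [/\ zopen U, U p & regular U f].

Definition germ_eq p f g : Prop :=
  exists U : set Z, [/\ zopen U, U p & forall q, U q -> f q = g q].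

(* The quotient of the local ring at p by the ideal (f) has dimension k. *)
Definition colength p f (k : nat) : Prop :=
  exists e : 'I_k -> Z -> C,
    (forall j, regular_at p (e j)) /\
    forall g, regular_at p g ->
      exists! a : 'rV[C]_k, exists h, regular_at p h /\
        germ_eq p g (fun q => \sum_j a 0 j * e j q + f q * h q).

(* The germ of f lies in the square of the maximal ideal of p. *)
Definition in_max_ideal_sq p f : Prop :=
  exists (k : nat) (a b : 'I_k -> Z -> C),
    [/\ forall j, regular_at p (a j) /\ a j p = 0,
        forall j, regular_at p (b j) /\ b j p = 0 &
        germ_eq p f (fun q => \sum_j a j q * b j q)].

(* df = \sum_k e_k dt_k in the cotangent space m / m^2 at p. *)
Definition differential_eq (n : nat) (t : 'I_n -> Z -> C) p f (e : 'rV[C]_n) :=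
  in_max_ideal_sq p (fun q => f q - f p - \sum_k e 0 k * (t k q - t k p)).

(* dt_1, ..., dt_n is a frame of the sheaf of differentials over U. *)
Definition coordinates (n : nat) (U : set Z) (t : 'I_n -> Z -> C) : Prop :=
  [/\ zopen U, forall k, regular U (t k) &
      forall V f, zopen V -> V `<=` U -> regular V f ->
        exists e : Z -> 'rV[C]_n,
          (forall k, regular V (fun q => e q 0 k)) /\
          forall p, V p -> forall a, differential_eq t p f a <-> a = e p].

(* The row of the partial derivatives of f at p in the coordinates t. *)
Definition partials (n : nat) (t : 'I_n -> Z -> C) p f : 'rV[C]_n :=
  if pselect (exists e, differential_eq t p f e) is left h
  then sval (cid h) else 0.

End LocalRing.

Definition smooth (n : nat) (Z : space) : Prop :=
  forall x : Z, exists (U : set Z) (t : 'I_n -> Z -> C), coordinates U t /\ U x.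

Section LineBundles.

(* A section is a family of functions s_i on the sets ldom i such that        *)
(* s_i = ltr i j * s_j. The chart lat x is one that contains x. The record    *)
(* holds the data; the cocycle conditions are is_lbundle.                     *)
Record lbundle (Z : space) := LBundle {
  lidx : Type;
  ldom : lidx -> set Z;
  lat : Z -> lidx;
  ltr : lidx -> lidx -> Z -> C }.

Definition is_lbundle (Z : space) (L : lbundle Z) : Prop :=
  [/\ forall i : lidx L, zopen (ldom i),
      forall x : Z, ldom (lat L x) x,
      forall i j : lidx L, regular (ldom i `&` ldom j) (ltr i j),
      forall (i : lidx L) x, ldom i x -> ltr i i x = 1 &
      forall (i j k : lidx L) x, ldom i x -> ldom j x -> ldom k x ->
        ltr i j x * ltr j k x = ltr i k x].

Definition is_section (Z : space) (L : lbundle Z) (W : set Z)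
    (s : lidx L -> Z -> C) : Prop :=
  (forall i, regular (W `&` ldom i) (s i)) /\
  (forall i j x, W x -> ldom i x -> ldom j x -> s i x = ltr i j x * s j x).

Definition ltensor (Z : space) (L M : lbundle Z) : lbundle Z :=
  @LBundle Z (lidx L * lidx M)%type
    (fun i => ldom i.1 `&` ldom i.2) (fun x => (lat L x, lat M x))
    (fun i j x => ltr i.1 j.1 x * ltr i.2 j.2 x).

Definition lpower (Z : space) (L : lbundle Z) (m : nat) : lbundle Z :=
  @LBundle Z (lidx L) (@ldom _ L) (lat L) (fun i j x => ltr i j x ^+ m).

Definition lpullback (Y Z : space) (f : Y -> Z) (L : lbundle Z) : lbundle Y :=
  @LBundle Y (lidx L) (fun i => f @^-1` ldom i) (fun y => lat L (f y))
    (fun i j y => ltr i j (f y)).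

Definition lrestrict (Z : space) (A : set Z) (L : lbundle Z) :
  lbundle (subspace A) := lpullback (@incl Z A) L.

(* An isomorphism from M to L is given in charts by invertible functions u. *)
Definition lisom (Z : space) (L M : lbundle Z) : Prop :=
  exists u : lidx L -> lidx M -> Z -> C,
    [/\ forall i j, regular (ldom i `&` ldom j) (u i j),
        forall i j x, ldom i x -> ldom j x -> u i j x != 0 &
        forall i i' j j' x, ldom i x -> ldom i' x -> ldom j x -> ldom j' x ->
          u i j x * ltr j j' x = ltr i i' x * u i' j' x].

Definition stable_base_locus (Z : space) (L : lbundle Z) : set Z :=
  [set x | forall (m : nat) (s : lidx (lpower L m) -> Z -> C), (0 < m)%N ->
     is_section setT s -> s (lat L x) x = 0].

(* h^0(L) >= r *)
Definition h0_ge (Z : space) (L : lbundle Z) (r : nat) : Prop :=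
  exists s : 'I_r -> lidx L -> Z -> C,
    (forall j, is_section setT (s j)) /\
    forall a : 'I_r -> C,
      (forall i x, ldom i x -> \sum_j a j * s j i x = 0) -> forall j, a j = 0.

Definition big (Z : space) (L : lbundle Z) : Prop :=
  exists k : nat, has_dim [set: Z] k /\
  exists2 b : R, 0 < b & exists m0 : nat, forall m : nat, (m0 <= m)%N ->
    exists2 r : nat, b * m%:R ^+ k <= r%:R & h0_ge (lpower L m) r.

End LineBundles.

Section Degree.
Context {Z : space}. (* in use, an irreducible projective curve *)

(* A nonzero rational section of L: a nonzero section over a nonempty open W. *)
Definition rational_section (L : lbundle Z) (W : set Z) (s : lidx L -> Z -> C) :
  Prop :=
  [/\ zopen W, is_section W s &
      exists i x, [/\ W x, ldom i x & s i x != 0]].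

(* The order of s at p is length(O_p / a) - length(O_p / b) when s = a / b in *)
(* a trivialization at p (Fulton, Intersection Theory, 1.2).                  *)
Definition order_at (L : lbundle Z) (W : set Z) (s : lidx L -> Z -> C)
    (p : Z) (v : int) : Prop :=
  exists (i : lidx L) (a b : Z -> C) (k l : nat),
    [/\ ldom i p, regular_at p a /\ regular_at p b,
        colength p a k /\ colength p b l,
        exists V : set Z, [/\ zopen V, V p &
          forall q, V q -> W q -> ldom i q -> b q * s i q = a q] &
        v = k%:Z - l%:Z].

Definition divisor_degree (L : lbundle Z) (W : set Z) (s : lidx L -> Z -> C)
    (e : int) : Prop :=
  exists (k : nat) (p : 'I_k -> Z) (v : 'I_k -> int),
    [/\ injective p, forall i, order_at W s (p i) (v i),
        forall q, (forall i, q <> p i) -> order_at W s q 0 &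
        e = \sum_i v i].

(* The degree of c_1(L): the degree of the divisor of any nonzero rational    *)
(* section of L.                                                              *)
Definition degree (L : lbundle Z) (e : int) : Prop :=
  forall W s, @rational_section L W s -> divisor_degree W s e.

End Degree.

(* The integral of c_1(L) over the curve A. *)
Definition intersection_number (Z : space) (A : set Z) (L : lbundle Z)
  (e : int) : Prop := degree (lrestrict A L) e.

Section ProjectiveSpace.

(* The projective space of lines of C^r. *)
Definition lines (r : nat) := {l : {vspace 'rV[C]_r} | \dim l == 1%N}.

(* Homogeneous coordinates. *)
Definition hcoord (r : nat) (l : lines r) : 'rV[C]_r := vpick (val l).

Lemma hcoord_neq0 (r : nat) (l : lines r) : exists k, hcoord l 0 k != 0.
Proof.
have hl : hcoord l != 0.
  by rewrite vpick0 -dimv_eq0; case: l => l /= /eqP ->.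
apply: contrapT => h; move/negP: hl; apply; apply/eqP/rowP => k.
rewrite mxE; apply/eqP; apply: contrapT => /negP hk; apply: h; by exists k.
Qed.

Definition some_coord (r : nat) (l : lines r) : 'I_r := xchoose (hcoord_neq0 l).

Definition heval (r : nat) (p : {mpoly C[r]}) (l : lines r) : C :=
  p.@[fun k => hcoord l 0 k].

Definition homogeneous (r d : nat) (p : {mpoly C[r]}) : Prop := p \is d.-homog.

Definition proj_space (N : nat) : space :=
  @Space (lines N.+1)
    (fun U => exists S : set {mpoly C[N.+1]},
       (forall p, S p -> exists d, homogeneous d p) /\
       U = [set x | exists2 p, S p & heval p x != 0])
    (fun U f => forall x, U x ->
       exists (S : set {mpoly C[N.+1]}) (d : nat) (p q : {mpoly C[N.+1]}),
         let V := [set y | exists2 r, S r & heval r y != 0] in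
         [/\ forall r, S r -> exists e, homogeneous e r,
             V x /\ V `<=` U, homogeneous d p, homogeneous d q &
             forall y, V y -> heval q y != 0 /\ f y = heval p y / heval q y]).

(* O(k) on the projective space; over {x_i <> 0} a form P of degree k is the  *)
(* function P / x_i^k.                                                        *)
Definition O_P (N : nat) (k : int) : lbundle (proj_space N) :=
  @LBundle (proj_space N) 'I_N.+1
    (fun i => [set x : lines N.+1 | hcoord x 0 i != 0])
    (fun x => some_coord (x : lines N.+1))
    (fun i j x => (hcoord (x : lines N.+1) 0 j / hcoord (x : lines N.+1) 0 i) ^ k).

Definition very_ample (Z : space) (L : lbundle Z) : Prop :=
  exists (M : nat) (f : Z -> proj_space M),
    closed_embedding f /\ lisom L (lpullback f (O_P M 1)).

Definition ample (Z : space) (L : lbundle Z) : Prop :=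
  exists2 m : nat, (0 < m)%N & very_ample (lpower L m).

End ProjectiveSpace.

Section VectorBundles.

(* A section is a family of columns s_i with s_i = vtr i j *m s_j. As for     *)
(* lbundle, the record only holds the data; the cocycle conditions hold for   *)
(* the cotangent bundle of a smooth space below, and for its twists.          *)
Record vbundle (Z : space) := VBundle {
  vrank : nat;
  vidx : Type;
  vdom : vidx -> set Z;
  vat : Z -> vidx;
  vtr : vidx -> vidx -> Z -> 'M[C]_vrank }.

Definition vtwist (Z : space) (E : vbundle Z) (L : lbundle Z) : vbundle Z :=
  @VBundle Z (vrank E) (vidx E * lidx L)%type
    (fun i => vdom i.1 `&` ldom i.2) (fun x => (vat E x, lat L x))
    (fun i j x => ltr i.2 j.2 x *: vtr i.1 j.1 x).

(* The cotangent bundle of a smooth space of dimension n: the charts are the  *)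
(* open sets with coordinates t, with frame dt_1, ..., dt_n, so that the      *)
(* transition matrices are the Jacobian matrices.                             *)
Definition cotangent (n : nat) (Z : space) : vbundle Z :=
  let idx := (set Z * ('I_n -> Z -> C))%type in
  let dom (i : idx) : set Z := [set x | coordinates i.1 i.2 /\ i.1 x] in
  @VBundle Z n idx dom
    (fun x => if pselect (exists i : idx, dom i x) is left h
              then sval (cid h) else (set0, fun _ _ => 0))
    (fun i j x => \matrix_(k, l) partials i.2 x (j.2 l) 0 k).

Section Projectivization.
Context {Z : space} (E : vbundle Z).

(* A rank one quotient of the fibre E_x is a nonzero linear form on E_x up to *)
(* scalars; it is recorded by its row of coefficients in the chart vat E x.   *)
Definition proj_pt := (Z * lines (vrank E))%type.

(* The coefficients of the linear form p in the chart i. *)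
Definition form_coord (i : vidx E) (p : proj_pt) : 'rV[C]_(vrank E) :=
  hcoord p.2 *m vtr (vat E p.1) i p.1.

(* A section over U of the m-th symmetric power of E, in a chart: a form of   *)
(* degree m whose coefficients are regular functions on U.                    *)
Definition sym_section (U : set Z) (m : nat) (Q : Z -> {mpoly C[vrank E]}) :=
  (forall x, U x -> homogeneous m (Q x)) /\
  (forall mu : 'X_{1..vrank E}, regular U (fun x => (Q x)@_mu)).

Definition sym_eval (i : vidx E) (Q : Z -> {mpoly C[vrank E]}) (p : proj_pt) :
  C := (Q p.1).@[fun k => form_coord i p 0 k].

Definition proj_open (W : set proj_pt) : Prop :=
  forall p, W p -> exists (i : vidx E) (U : set Z) m Q,
    [/\ zopen U /\ U `<=` vdom i, U p.1, sym_section U m Q,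
        sym_eval i Q p != 0 &
        forall p', U p'.1 -> sym_eval i Q p' != 0 -> W p'].

Definition proj_regular (W : set proj_pt) (f : proj_pt -> C) : Prop :=
  forall p, W p ->
    exists (V : set proj_pt) (i : vidx E) (U : set Z) m P Q,
      [/\ [/\ proj_open V, V p & V `<=` W],
          [/\ zopen U, U `<=` vdom i & forall p', V p' -> U p'.1],
          sym_section U m P, sym_section U m Q &
          forall p', V p' ->
            sym_eval i Q p' != 0 /\ f p' = sym_eval i P p' / sym_eval i Q p'].

Definition proj_bundle : space := @Space proj_pt proj_open proj_regular.

Definition proj_map : proj_bundle -> Z := fun p => p.1.

(* O(1) on P(E); over the set of (i, k), a section e of E is the function     *)
(* xi(e) / xi_k, where xi is the linear form in the chart i.                  *)
Definition O_proj1 : lbundle proj_bundle :=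
  @LBundle proj_bundle (vidx E * 'I_(vrank E))%type
    (fun i => [set p : proj_bundle | vdom i.1 p.1 /\ form_coord i.1 p 0 i.2 != 0])
    (fun p => (vat E p.1, some_coord p.2))
    (fun i j p => form_coord j.1 p 0 j.2 / form_coord i.1 p 0 i.2).

End Projectivization.

Definition ample_modulo (Z : space) (E : vbundle Z) (T : set Z) : Prop :=
  forall H : lbundle Z, is_lbundle H -> ample H ->
  exists2 eps0 : R, 0 < eps0 & forall eps : R, 0 < eps -> eps < eps0 ->
  forall (A : set (proj_bundle E)) (u v : int),
    irreducible_curve A ->
    intersection_number A (O_proj1 E) u ->
    intersection_number A (lpullback (@proj_map Z E) H) v ->
    u%:~R < eps * v%:~R ->
    @proj_map Z E @` A `<=` T.

End VectorBundles.

Section CompleteIntersections.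
Context {N c : nat}.
Implicit Types (F : 'I_c -> {mpoly C[N.+1]}) (d : 'I_c -> nat).

Definition zero_locus F : set (proj_space N) :=
  [set x | forall i, heval (F i) x = 0].

Definition ci F : space := subspace (zero_locus F).

Definition O_ci F (k : int) : lbundle (ci F) :=
  lrestrict (zero_locus F) (O_P N k).

(* The homogeneous ideal of the zero locus of F is generated by the F_i. *)
Definition generates_ideal F : Prop :=
  forall (e : nat) (p : {mpoly C[N.+1]}), homogeneous e p ->
    (forall x, zero_locus F x -> heval p x = 0) ->
    exists A : 'I_c -> {mpoly C[N.+1]}, p = \sum_i A i * F i.

Definition smooth_ci (n : nat) F : Prop :=
  [/\ generates_ideal F, has_dim [set: ci F] n & smooth n (ci F)].

(* Representatives of the points of the product of the projective spaces of   *)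
(* hypersurfaces of degrees d_i.                                              *)
Definition equations d F : Prop :=
  forall i, homogeneous (d i) (F i) /\ F i != 0.

(* The coefficients of F, indexed by pairs of an equation and a monomial. *)
Definition coef_idx d := ('I_c * 'X_{1..N.+1 < (\max_i d i).+1})%type.

Definition coefs d F (j : 'I_#|{: coef_idx d}|) : C :=
  let a : coef_idx d := enum_val j in (F a.1)@_(a.2).

(* Phi is homogeneous in the coefficients of each equation. *)
Definition multihomogeneous d (Phi : {mpoly C[#|{: coef_idx d}|]}) : Prop :=
  exists e : 'I_c -> nat, forall mu, mu \in msupp Phi -> forall i,
    (\sum_(j | (enum_val j : coef_idx d).1 == i) mu j)%N = e i.

Definition zopen_equations d (U : set ('I_c -> {mpoly C[N.+1]})) : Prop :=
  exists S : set {mpoly C[#|{: coef_idx d}|]},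
    (forall Phi, S Phi -> multihomogeneous Phi) /\
    forall F, equations d F ->
      U F <-> exists2 Phi, S Phi & Phi.@[@coefs d F] != 0.

(* A generic complete intersection of dimension n and multidegree d has P. *)
Definition generic_ci (n : nat) d (P : ('I_c -> {mpoly C[N.+1]}) -> Prop) :
  Prop :=
  exists U : set ('I_c -> {mpoly C[N.+1]}),
    [/\ zopen_equations d U, exists F, equations d F /\ U F &
        forall F, equations d F -> U F -> smooth_ci n F /\ P F].

End CompleteIntersections.

(* The property required of the constant delta_(N, n, a). *)
Definition is_delta (N n a delta : nat) : Prop :=
  (0 < delta)%N /\
  forall (c : nat) (d : 'I_c -> nat),
    N = (n + c)%N -> (n <= c)%N -> (forall i, (delta <= d i)%N) ->
    generic_ci (N := N) n d (fun F =>
      let Om := cotangent n (ci F) in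
      let L := ltensor (O_proj1 Om)
                 (lpullback (@proj_map _ Om) (O_ci F (- a%:Z))) in
      big L /\
      exists Y : set (ci F),
        [/\ zclosed Y, codim_ge Y 2 &
            @proj_map _ Om @` stable_base_locus L `<=` Y]).

End SpacesWithFunctions.

Arguments space R : clear implicits.
Arguments is_delta R N n a delta : clear implicits.

(* Main.v *)
(* Let s be a section of (O(1) (x) O_X(-a-1))^m on P(Om) that is nonzero at a  *)
(* point p0 of the curve A, which exists when p0 does not map to the subset T *)
(* containing the image of the stable base locus. On A, s gives a nonzero map *)
(* O_X(m) -> O_P(Om(-a))(m), so u = deg O_P(Om(-a))(1)|A >= deg O_X(1)|A. If  *)
(* f is the embedding given by H^m0, then near any point f is given by forms  *)
(* of some degree, bounded by k by Noetherianity, and dividing them by the    *)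
(* homogeneous coordinates of the target gives a nonzero map from H^m0 to     *)
(* O_X(k) on A; it is everywhere defined on A because A is irreducible. Hence *)
(* m0 v <= k u, where v = deg H|A, and also 0 <= u, so u >= (m0 / k) v.       *)
(*   The degree hypotheses say that all rational sections of a bundle have    *)
(* divisors of the same degree, so no properness argument is needed to see    *)
(* that principal divisors have degree zero.                                  *)
Require Import Defs.
From HB Require Import structures.
From mathcomp Require Import all_boot all_order all_algebra.
From mathcomp Require Import complex mpoly.
From mathcomp Require Import boolp classical_sets functions reals.
From mathcomp Require Import ring zify.

Set Implicit Arguments.
Unset Strict Implicit.
Unset Printing Implicit Defensive.

Import Order.TTheory GRing.Theory Num.Theory.

Local Open Scope classical_set_scope.
Local Open Scope ring_scope.
Local Open Scope complex_scope.

(** Write Om for the cotangent bundle of X, E = Om(-a) and pi for the projection of P(E). The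
    exceptional set is the closed subset Y that the property of [delta] for a+1 provides. The
    bundles P(E) and P(Om) have the same points, and O(1) on P(E) is O(1) on P(Om) twisted by
    O_X(-a). Let p lie on a curve A with pi(p) outside Y. Some power of O_P(Om)(1) tensor O_X(-a-1)
    has a section that is nonzero at p, and [lhom_at_section] reads it as a map O_X(m) -> O_P(E)(m):
    the spare twist by O_X(1) is the positivity that is gained.

    It remains to compare O_X(1) with an ample H such that H^m0 is very ample.
    [given_by_forms_bounded] and [lhom_at_given_by_forms] give a k that does not depend on the curve
    and a map H^m0 -> O_X(k) on A that is nonzero at p; [lhom_at_O_P] gives a map from the trivial
    bundle to O_X(k). Composing, [degree_le_lhom_at] yields m0 v <= k u and 0 <= u for the degrees u
    of O_P(E)(1) and v of H on A. This excludes u < eps v as soon as eps < m0 / k.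

    The degree inequality is [degree_le_lhom]: on an irreducible space a nonzero map M^q -> L^(P+1)
    forces q deg M <= (P+1) deg L. Orders of rational sections of L and M themselves are compared at
    each point; the local input is that colengths add under products ([colength_mul]) and grow under
    divisibility ([colength_dvd]) in a local domain.

    The remaining work shows that the spaces and bundles in play, which are defined as bare data,
    satisfy the sheaf and cocycle axioms. *)

(** * Spaces with functions and their morphisms *)

Section RegularFunctions.
Context {R : realType}.
Local Notation C := R[i].

Record function_space (Z : Defs.space R) : Prop := FunctionSpace {
  open_full : zopen [set: Z];
  open_inter : forall U V : set Z, zopen U -> zopen V -> zopen (U `&` V);
  open_local : forall U : set Z,
    (forall x, U x -> exists V : set Z, [/\ zopen V, V x & V `<=` U]) ->
    zopen U;
  reg_const : forall (U : set Z) (k : C), zopen U -> regular U (fun=> k);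
  reg_add : forall (U : set Z) f g, zopen U -> regular U f -> regular U g ->
    regular U (fun x => f x + g x);
  reg_mul : forall (U : set Z) f g, zopen U -> regular U f -> regular U g ->
    regular U (fun x => f x * g x);
  reg_inv : forall (U : set Z) f, zopen U -> regular U f ->
    (forall x, U x -> f x != 0) -> regular U (fun x => (f x)^-1);
  reg_sub : forall (U V : set Z) f g, zopen V -> V `<=` U -> regular U f ->
    (forall x, V x -> f x = g x) -> regular V g;
  reg_local : forall (U : set Z) f,
    (forall x, U x ->
       exists V : set Z, [/\ zopen V, V x & regular (U `&` V) f]) ->
    regular U f;
  open_neq0 : forall (U : set Z) f, zopen U -> regular U f ->
    zopen [set x | U x /\ f x != 0] }.

Section Theory.
Variables (Z : Defs.space R) (hZ : function_space Z).
Implicit Types (U V : set Z) (f g : Z -> C).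

Lemma reg_ext U f g : zopen U -> regular U f -> (forall x, U x -> f x = g x) ->
  regular U g.
Proof. by move=> oU rf e; apply: (reg_sub hZ oU _ rf e). Qed.

Lemma reg_restrict U V f : zopen V -> V `<=` U -> regular U f -> regular V f.
Proof. by move=> oV VU rf; apply: (reg_sub hZ oV VU rf). Qed.

Lemma reg_exp U f m : zopen U -> regular U f -> regular U (fun x => f x ^+ m).
Proof.
move=> oU rf; elim: m => [|m IH].
  exact: (reg_const hZ 1 oU).
by apply: (reg_ext oU (reg_mul hZ oU rf IH)) => x _; rewrite exprS.
Qed.

Lemma reg_opp U f : zopen U -> regular U f -> regular U (fun x => - f x).
Proof.
move=> oU rf; apply: (reg_ext oU (reg_mul hZ oU (reg_const hZ (-1) oU) rf)).
by move=> x _; rewrite mulN1r.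
Qed.

Lemma reg_subr U f g : zopen U -> regular U f -> regular U g ->
  regular U (fun x => f x - g x).
Proof. by move=> oU rf rg; apply: reg_add => //; apply: reg_opp. Qed.

Lemma reg_sum U (I : Type) (r : seq I) (P : pred I) (f : I -> Z -> C) :
  zopen U -> (forall i, P i -> regular U (f i)) ->
  regular U (fun x => \sum_(i <- r | P i) f i x).
Proof.
move=> oU rf; elim: r => [|i r IH].
  by apply: (reg_ext oU (reg_const hZ 0 oU)) => x _; rewrite big_nil.
case Pi: (P i).
  apply: (reg_ext oU (reg_add hZ oU (rf i Pi) IH)) => x _.
  by rewrite big_cons Pi.
by apply: (reg_ext oU IH) => x _; rewrite big_cons Pi.
Qed.

End Theory.

Lemma function_space_induced (T : Type) (Z : Defs.space R) (f : T -> Z) :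
  function_space Z -> function_space (induced f).
Proof.
move=> hZ; split => /=.
- by exists setT; split=> //; apply: open_full.
- move=> _ _ [U [oU ->]] [V [oV ->]]; exists (U `&` V); split=> //.
  exact: open_inter.
- move=> U h.
  (* An induced open set has to be the preimage of a single open set: take the union of all open
     sets whose preimage lies in U. *)
  exists [set z | exists W : set Z, [/\ zopen W, W z & f @^-1` W `<=` U]]; split.
    apply: (open_local hZ) => z [W [oW Wz WU]]; exists W; split=> // y Wy.
    by exists W.
  apply/seteqP; split=> x /=.
    by move=> /h [_ [[W [oW ->]] Wx WU]]; exists W.
  by move=> [W [oW Wx]]; apply.
- move=> U k _ x Ux; exists setT, (fun=> k); split=> //.
    exact: open_full.
  by apply: reg_const => //; apply: open_full.
- move=> U g h _ rg rh x Ux.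
  have [W [g' [oW Wx rg' eg]]] := rg x Ux.
  have [W' [h' [oW' Wx' rh' eh]]] := rh x Ux.
  have oWW := open_inter hZ oW oW'.
  exists (W `&` W'), (fun z => g' z + h' z); split=> //.
    by apply: reg_add => //; [apply: reg_restrict rg' => // ? []
                             |apply: reg_restrict rh' => // ? []].
  by move=> y Uy [Wy Wy']; rewrite eg // eh.
- move=> U g h _ rg rh x Ux.
  have [W [g' [oW Wx rg' eg]]] := rg x Ux.
  have [W' [h' [oW' Wx' rh' eh]]] := rh x Ux.
  have oWW := open_inter hZ oW oW'.
  exists (W `&` W'), (fun z => g' z * h' z); split=> //.
    by apply: reg_mul => //; [apply: reg_restrict rg' => // ? []
                             |apply: reg_restrict rh' => // ? []].
  by move=> y Uy [Wy Wy']; rewrite eg // eh.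
- move=> U g _ rg g0 x Ux.
  have [W [g' [oW Wx rg' eg]]] := rg x Ux.
  have oW0 := open_neq0 hZ oW rg'.
  exists [set z | W z /\ g' z != 0], (fun z => (g' z)^-1); split=> //.
  + by split=> //; rewrite -eg // g0.
  + by apply: reg_inv => //; [apply: reg_restrict rg' => // ? []|move=> ? []].
  + by move=> y Uy [Wy _]; rewrite eg.
- move=> U V g h _ VU rg e x Vx.
  have [W [g' [oW Wx rg' eg]]] := rg x (VU _ Vx).
  by exists W, g'; split=> // y Vy Wy; rewrite -e // eg //; apply: VU.
- move=> U g h x Ux.
  have [_ [[V [oV ->]] Vx rg]] := h x Ux.
  have [W [g' [oW Wx rg' eg]]] := rg x (conj Ux Vx).
  have oWV := open_inter hZ oW oV.
  exists (W `&` V), g'; split=> //.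
    by apply: reg_restrict rg' => // ? [].
  by move=> y Uy [Wy Vy]; apply: eg.
- move=> U g [V [oV ->]] rg.
  exists [set z | exists W : set Z,
    [/\ zopen W, W z & f @^-1` W `<=` [set x | V (f x) /\ g x != 0]]]; split.
    apply: (open_local hZ) => z [W [oW Wz WU]]; exists W; split=> // y Wy.
    by exists W.
  apply/seteqP; split=> x /=; last by move=> [W [oW Wx]]; apply.
  move=> [Vx gx]; have [W [g' [oW Wx rg' eg]]] := rg x Vx.
  have oW0 := open_neq0 hZ oW rg'.
  exists (V `&` [set z | W z /\ g' z != 0]); split=> /=.
  + exact: open_inter.
  + by split=> //; split=> //; rewrite -eg.
  + by move=> y [Vy [Wy g'y]]; split=> //; rewrite eg.
Qed.

Lemma function_space_subspace (Z : Defs.space R) (A : set Z) :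
  function_space Z -> function_space (subspace A).
Proof. exact: function_space_induced. Qed.

Definition morphism (Y Z : Defs.space R) (f : Y -> Z) : Prop :=
  (forall U : set Z, zopen U -> zopen (f @^-1` U)) /\
  forall (U : set Z) g, zopen U -> regular U g -> regular (f @^-1` U) (g \o f).

Lemma incl_morphism (Z : Defs.space R) (A : set Z) : morphism (@Defs.incl R Z A).
Proof.
split=> [U oU|U g oU rg]; first by exists U.
by move=> x Ux; exists U, g; split.
Qed.

Lemma comp_morphism (X Y Z : Defs.space R) (f : X -> Y) (g : Y -> Z) :
  morphism f -> morphism g -> morphism (g \o f).
Proof.
move=> [of_ rf] [og rg]; split=> [U oU|U h oU rh].
  exact: (of_ _ (og _ oU)).
exact: (rf _ _ (og _ oU) (rg _ _ oU rh)).
Qed.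

Lemma closed_embedding_morphism (Y Z : Defs.space R) (f : Y -> Z) :
  closed_embedding f -> morphism f.
Proof.
move=> [_ _ ho hr].
have o U : zopen U -> zopen (f @^-1` U) by move=> oU; apply/ho; exists U.
split=> // U g oU rg; apply/hr; first exact: o.
by move=> x Ux; exists U, g; split.
Qed.

End RegularFunctions.

(** * Local rings: congruences, colengths, and the domain property *)

Section Germs.
Context {R : realType}.
Local Notation C := R[i].
Variables (Z : Defs.space R) (hZ : function_space Z).

Definition irreducible_space : Prop := forall U V : set Z,
  zopen U -> zopen V -> U !=set0 -> V !=set0 -> (U `&` V) !=set0.

Variable p : Z.
Implicit Types f g h : Z -> C.

Lemma regular_at_const (k : C) : regular_at p (fun=> k).
Proof.
exists setT; split=> //; first exact: open_full.
exact: (reg_const hZ k (open_full hZ)).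
Qed.

Lemma regular_at2 f g : regular_at p f -> regular_at p g ->
  exists U : set Z, [/\ zopen U, U p, regular U f & regular U g].
Proof.
move=> [U [oU Up rf]] [V [oV Vp rg]].
have oUV := open_inter hZ oU oV.
by exists (U `&` V); split=> //; [apply: (reg_restrict hZ _ _ rf)
                                 |apply: (reg_restrict hZ _ _ rg)] => // ? [].
Qed.

Lemma regular_at_add f g : regular_at p f -> regular_at p g ->
  regular_at p (fun q => f q + g q).
Proof.
move=> rf rg; have [U [oU Up {}rf {}rg]] := regular_at2 rf rg.
by exists U; split=> //; apply: reg_add.
Qed.

Lemma regular_at_mul f g : regular_at p f -> regular_at p g ->
  regular_at p (fun q => f q * g q).
Proof.
move=> rf rg; have [U [oU Up {}rf {}rg]] := regular_at2 rf rg.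
by exists U; split=> //; apply: reg_mul.
Qed.

Lemma regular_at_exp f m : regular_at p f -> regular_at p (fun q => f q ^+ m).
Proof. by move=> [U [oU Up rf]]; exists U; split=> //; apply: reg_exp. Qed.

Lemma regular_at_sum (I : Type) (r : seq I) (f : I -> Z -> C) :
  (forall i, regular_at p (f i)) ->
  regular_at p (fun q => \sum_(i <- r) f i q).
Proof.
move=> rf; elim: r => [|i r IH].
  have [U [oU Up r0]] := regular_at_const 0; exists U; split=> //.
  by apply: (reg_ext hZ oU r0) => x _; rewrite big_nil.
have [U [oU Up r0]] := regular_at_add (rf i) IH; exists U; split=> //.
by apply: (reg_ext hZ oU r0) => x _; rewrite big_cons.
Qed.

Lemma regular_at_lincomb k (a : 'I_k -> C) (e : 'I_k -> Z -> C) :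
  (forall i, regular_at p (e i)) ->
  regular_at p (fun q => \sum_i a i * e i q).
Proof.
move=> re; apply: (@regular_at_sum _ _ (fun i q => a i * e i q)) => i.
by apply: regular_at_mul => //; apply: regular_at_const.
Qed.

Lemma germ_eqP f g : (forall q, f q = g q) -> germ_eq p f g.
Proof. by move=> e; exists setT; split=> //; apply: open_full. Qed.

Lemma germ_eq_sym f g : germ_eq p f g -> germ_eq p g f.
Proof. by move=> [U [oU Up e]]; exists U; split=> // q /e. Qed.

Lemma germ_eq2 (P Q S : Z -> Prop) :
  (exists U : set Z, [/\ zopen U, U p & forall q, U q -> P q]) ->
  (exists U : set Z, [/\ zopen U, U p & forall q, U q -> Q q]) ->
  (forall q, P q -> Q q -> S q) ->
  exists U : set Z, [/\ zopen U, U p & forall q, U q -> S q].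
Proof.
move=> [U [oU Up e]] [V [oV Vp e']] h; exists (U `&` V); split=> //.
  exact: open_inter.
by move=> q [Uq Vq]; apply: h; [apply: e|apply: e'].
Qed.

Lemma germ_eq_trans g f h : germ_eq p f g -> germ_eq p g h -> germ_eq p f h.
Proof. by move=> e1 e2; apply: (germ_eq2 e1 e2) => q -> ->. Qed.

(** Congruence of germs modulo the ideal (f); [colength] counts a basis of the quotient by this
    relation. *)
Definition congr_mod f g g' : Prop :=
  exists h, regular_at p h /\ germ_eq p g (fun q => g' q + f q * h q).

Lemma congr_germ f g g' : germ_eq p g g' -> congr_mod f g g'.
Proof.
move=> e; exists (fun=> 0); split; first exact: regular_at_const.
apply: (germ_eq_trans e); apply: germ_eqP => q; by rewrite mulr0 addr0.
Qed.

Lemma congr_add f g1 g2 h1 h2 : congr_mod f g1 h1 -> congr_mod f g2 h2 ->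
  congr_mod f (fun q => g1 q + g2 q) (fun q => h1 q + h2 q).
Proof.
move=> [k1 [r1 e1]] [k2 [r2 e2]]; exists (fun q => k1 q + k2 q); split.
  exact: regular_at_add.
by apply: (germ_eq2 e1 e2) => q -> ->; rewrite mulrDr addrACA.
Qed.

Lemma congr_trans f g2 g1 g3 : congr_mod f g1 g2 -> congr_mod f g2 g3 ->
  congr_mod f g1 g3.
Proof.
move=> [k1 [r1 e1]] [k2 [r2 e2]]; exists (fun q => k2 q + k1 q); split.
  exact: regular_at_add.
by apply: (germ_eq2 e1 e2) => q -> ->; rewrite mulrDr addrA.
Qed.

Lemma congr_scale f (a : C) g g' : congr_mod f g g' ->
  congr_mod f (fun q => a * g q) (fun q => a * g' q).
Proof.
move=> [h [rh [U [oU Up e]]]]; exists (fun q => a * h q); split.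
  by apply: regular_at_mul => //; apply: regular_at_const.
by exists U; split=> // q /e ->; rewrite mulrDr mulrCA.
Qed.

Lemma congr_lincomb f k (a : 'I_k -> C) (e e' : 'I_k -> Z -> C) :
  (forall i, congr_mod f (e i) (e' i)) ->
  congr_mod f (fun q => \sum_i a i * e i q) (fun q => \sum_i a i * e' i q).
Proof.
move=> he; elim: (index_enum _) => [|i r IH].
  by apply: congr_germ; apply: germ_eqP => q; rewrite !big_nil.
have h := congr_add (congr_scale (a i) (he i)) IH.
apply: (congr_trans _ (congr_trans h _)); apply: congr_germ; apply: germ_eqP;
  by move=> q; rewrite big_cons.
Qed.

Lemma congr_dvd f f' c g g' : regular_at p c ->
  germ_eq p f' (fun q => c q * f q) -> congr_mod f' g g' -> congr_mod f g g'.
Proof.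
move=> rc ef [h [rh e]]; exists (fun q => c q * h q); split.
  exact: regular_at_mul.
by apply: (germ_eq2 ef e) => q -> ->; rewrite -mulrA mulrCA.
Qed.

(** Since f' = c f, O/(f) is a quotient of O/(f'). In coordinates, [B] writes the basis of O/(f) in
    that of O/(f') and [D] goes back; uniqueness of coordinates modulo f makes the product the
    identity, which bounds the rank. *)
Lemma colength_dvd f f' c k l : regular_at p c ->
  germ_eq p f' (fun q => c q * f q) -> colength p f k -> colength p f' l ->
  (k <= l)%N.
Proof.
move=> rc ef [e [re ue]] [e' [re' ue']].
have /choice [B hB] : forall j, exists b : 'rV[C]_l,
    congr_mod f' (e j) (fun q => \sum_i b 0 i * e' i q).
  by move=> j; have [b [hb _]] := ue' _ (re j); exists b.
have /choice [D hD] : forall i, exists d : 'rV[C]_k,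
    congr_mod f (e' i) (fun q => \sum_j d 0 j * e j q).
  by move=> i; have [d [hd _]] := ue _ (re' i); exists d.
pose MB := \matrix_(j, i) B j 0 i; pose MD := \matrix_(i, j) D i 0 j.
suff : MB *m MD = 1%:M by exact: mulmx1_min.
apply/row_matrixP => j.
have [a [_ ua]] := ue _ (re j).
transitivity a.
  apply/esym; apply: ua; apply: congr_trans (congr_dvd rc ef (hB j)) _.
  apply: congr_trans (congr_lincomb (B j 0) hD) _.
  apply: congr_germ; apply: germ_eqP => q.
  under eq_bigr do rewrite mulr_sumr.
  rewrite exchange_big /=; apply: eq_bigr => j' _.
  rewrite !mxE mulr_suml; apply: eq_bigr => i _.
  by rewrite !mxE mulrA.
apply: ua; apply: congr_germ; apply: germ_eqP => q.
rewrite (bigD1 j) //= big1 ?addr0 => [|i ij].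
  by rewrite !mxE eqxx mul1r.
by rewrite !mxE eq_sym (negPf ij) mul0r.
Qed.

Lemma colength_uniq f k l : colength p f k -> colength p f l -> k = l.
Proof.
have h : germ_eq p f (fun q => 1 * f q) by apply: germ_eqP => q; rewrite mul1r.
move=> hk hl; apply/eqP; rewrite eqn_leq.
rewrite (colength_dvd (regular_at_const 1) h hk hl).
by rewrite (colength_dvd (regular_at_const 1) h hl hk).
Qed.

Lemma colength_germ f g k : germ_eq p f g -> colength p f k -> colength p g k.
Proof.
have h u v a b : germ_eq p u v -> congr_mod u a b -> congr_mod v a b.
  move=> euv; apply: (congr_dvd (regular_at_const 1)).
  by apply: (germ_eq_trans euv); apply: germ_eqP => q; rewrite mul1r.
move=> efg [e [re ue]]; exists e; split=> // x rx.
have [a [ha ua]] := ue x rx; exists a; split; first exact: h ha.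
by move=> b hb; apply: ua; apply: h hb; apply: germ_eq_sym.
Qed.

Lemma colength1 : colength p (fun=> 1) 0.
Proof.
exists (fun i _ => 0); split; first by case.
move=> g rg; exists 0; split; last by move=> a _; apply/rowP; case.
exists g; split=> //; apply: germ_eqP => q.
by rewrite big_ord0 add0r mul1r.
Qed.

Hypothesis irr : irreducible_space.

(** Identity principle: near p the locus where f and g differ is open, so if it were nonempty it
    would meet U by irreducibility. *)
Lemma dense_germ_eq (U : set Z) f g : regular_at p f -> regular_at p g ->
  zopen U -> U !=set0 ->
  (exists V : set Z,
     [/\ zopen V, V p & forall q, V q -> U q -> f q = g q]) ->
  germ_eq p f g.
Proof.
move=> rf rg oU U0 [V [oV Vp e]].
have [W [oW Wp rf' rg']] := regular_at2 rf rg.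
have oVW := open_inter hZ oV oW.
exists (V `&` W); split=> // q [Vq Wq]; apply/eqP; rewrite -subr_eq0.
apply: contrapT => /negP fgq.
have rfg : regular (V `&` W) (fun x => f x - g x).
  by apply: reg_subr => //; [apply: reg_restrict rf' => // ? []
                            |apply: reg_restrict rg' => // ? []].
have [x [[[Vx _] fgx] Ux]] :
    ([set x | (V `&` W) x /\ f x - g x != 0] `&` U) !=set0.
  by apply: irr => //; [apply: open_neq0|exists q].
by move: fgx; rewrite e // subrr eqxx.
Qed.

(** The local ring is a domain: a nonzero germ f is nonvanishing on a nonempty open set, where it
    cancels pointwise, and density does the rest. *)
Lemma germ_mulI f g h : regular_at p f -> regular_at p g -> regular_at p h ->
  ~ germ_eq p f (fun=> 0) ->
  germ_eq p (fun q => f q * g q) (fun q => f q * h q) -> germ_eq p g h.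
Proof.
move=> [U [oU Up rf]] rg rh f0 [V [oV Vp e]].
apply: (@dense_germ_eq [set x | U x /\ f x != 0]) => //.
- exact: open_neq0.
- apply: contrapT => h0; apply: f0; exists U; split=> // q Uq.
  by apply: contrapT => /eqP fq; apply: h0; exists q.
- exists V; split=> // q Vq [_ fq]; apply: (mulfI fq); exact: e.
Qed.

Lemma germ_mul_neq0 f g : regular_at p f -> regular_at p g ->
  ~ germ_eq p f (fun=> 0) -> ~ germ_eq p g (fun=> 0) ->
  ~ germ_eq p (fun q => f q * g q) (fun=> 0).
Proof.
move=> rf rg f0 g0 fg; apply: g0.
apply: (germ_mulI rf rg (regular_at_const 0) f0).
by apply: (germ_eq_trans fg); apply: germ_eqP => q; rewrite mulr0.
Qed.

Lemma germ_exp_neq0 f m : regular_at p f ->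
  ~ germ_eq p f (fun=> 0) -> ~ germ_eq p (fun q => f q ^+ m) (fun=> 0).
Proof.
move=> rf f0; elim: m => [|m IH].
  move=> [U [oU Up e]]; have := e p Up; rewrite expr0; apply/eqP.
  exact: oner_neq0.
move=> fm; apply: (germ_mul_neq0 rf (regular_at_exp m rf) f0 IH).
by apply: germ_eq_trans fm; apply: germ_eqP => q; rewrite exprS.
Qed.

(* The sequence 0 -> O/g -> O/fg -> O/f -> 0, with first map f, is exact. *)
Lemma colength_mul f g k l : regular_at p f -> regular_at p g ->
  ~ germ_eq p f (fun=> 0) -> colength p f k -> colength p g l ->
  colength p (fun q => f q * g q) (k + l).
Proof.
move=> rf rg f0 [e [re ue]] [e' [re' ue']].
pose E (j : 'I_(k + l)) : Z -> C :=
  match fintype.split j with inl i => e i | inr i => fun q => f q * e' i q end.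
have sumE (a : 'rV[C]_(k + l)) q : \sum_j a 0 j * E j q =
    \sum_i lsubmx a 0 i * e i q + f q * \sum_i rsubmx a 0 i * e' i q.
  rewrite big_split_ord /= mulr_sumr; congr (_ + _); apply: eq_bigr => i _.
    by rewrite /E (unsplitK (inl i)) mxE.
  by rewrite /E (unsplitK (inr i)) mxE mulrCA.
exists E; split.
  move=> j; rewrite /E; case: (fintype.split j) => i //.
  exact: regular_at_mul.
move=> x rx; have [a [[y [ry ea]] ua]] := ue x rx.
have [b [[z [rz eb]] ub]] := ue' y ry.
exists (row_mx a b); split.
  exists z; split=> //; apply: (germ_eq2 ea eb) => q -> ->.
  by rewrite sumE row_mxKl row_mxKr mulrDr addrA mulrA.
move=> c [w [rw ec]].
have rc2 : regular_at p (fun q => \sum_i rsubmx c 0 i * e' i q + g q * w q).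
  by apply: regular_at_add;
    [apply: regular_at_lincomb|apply: regular_at_mul].
have al : a = lsubmx c.
  apply: ua; exists (fun q => \sum_i rsubmx c 0 i * e' i q + g q * w q).
  split=> //; case: ec => U [oU Up ec]; exists U; split=> // q Uq.
  by rewrite ec // sumE mulrDr !mulrA addrA.
suff br : b = rsubmx c by rewrite al br hsubmxK.
apply: ub; exists w; split=> //.
apply: (germ_mulI rf ry rc2 f0).
apply: (germ_eq2 ea ec) => q -> /esym.
by rewrite sumE al -!addrA => /addrI <-; rewrite mulrDr mulrA.
Qed.

Lemma colength_exp f k m : regular_at p f -> ~ germ_eq p f (fun=> 0) ->
  colength p f k -> colength p (fun q => f q ^+ m) (m * k).
Proof.
move=> rf f0 hf; elim: m => [|m IH]; first exact: colength1.
have := colength_mul rf (regular_at_exp m rf) f0 hf IH; rewrite -mulSn.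
by apply: colength_germ; apply: germ_eqP => q; rewrite exprS.
Qed.

(* A domain of finite dimension over a field is a field. *)
Lemma colength_artinian f k k0 : regular_at p f -> ~ germ_eq p f (fun=> 0) ->
  colength p (fun=> 0) k0 -> colength p f k -> k = 0%N.
Proof.
move=> rf f0 h0 hf.
have := colength_mul rf (regular_at_const 0) f0 hf h0.
move=> /(@colength_germ _ (fun=> 0)) h.
have /(colength_uniq h0) : colength p (fun=> 0) (k + k0).
  by apply: h; apply: germ_eqP => q; rewrite mulr0.
by move=> /eqP; rewrite -{1}[k0]add0n eqn_add2r => /eqP.
Qed.

End Germs.

(** * Homomorphisms of line bundles and their effect on degrees *)

Section LineBundleDegree.
Context {R : realType}.
Local Notation C := R[i].
Implicit Types Y Z : Defs.space R.

(* A homomorphism from M to L, given in charts: lisom without invertibility. *)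
Definition lhom Z (L M : lbundle Z) (u : lidx L -> lidx M -> Z -> C) : Prop :=
  (forall i j, regular (ldom i `&` ldom j) (u i j)) /\
  (forall i i' j j' x, ldom i x -> ldom i' x -> ldom j x -> ldom j' x ->
     u i j x * ltr j j' x = ltr i i' x * u i' j' x).

Lemma lhom_neq0 Z (L M : lbundle Z) u i i' j j' x :
  @lhom Z L M u -> is_lbundle M ->
  ldom i x -> ldom i' x -> ldom j x -> ldom j' x ->
  u i j x != 0 -> u i' j' x != 0.
Proof.
move=> [_ hu] [_ _ _ hM1 hM] ix i'x jx j'x; apply: contraNN => /eqP u0.
have := hu i i' j j' x ix i'x jx j'x; rewrite u0 mulr0 => /eqP.
rewrite mulf_eq0 => /orP[//|/eqP m0].
by move: (hM j j' j x jx j'x jx); rewrite m0 mul0r hM1 // => /esym/eqP;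
  rewrite oner_eq0.
Qed.

Lemma lbundle_neq0 Z (L : lbundle Z) i j x : is_lbundle L ->
  ldom i x -> ldom j x -> ltr (l := L) i j x != 0.
Proof.
move=> [_ _ _ h1 h2] ix jx; apply/eqP => l0.
by move: (h2 i j i x ix jx ix); rewrite l0 mul0r h1 // => /esym/eqP;
  rewrite oner_eq0.
Qed.

(** The middle chart [lat M x] varies with x without any regularity. By [ind] the product does not
    depend on it, so near each point a fixed chart computes it. *)
Lemma lhom_comp Z (hZ : function_space Z) (L M K : lbundle Z) u w :
  is_lbundle L -> is_lbundle M -> is_lbundle K ->
  @lhom Z L M u -> @lhom Z M K w ->
  @lhom Z L K (fun i k x => u i (lat M x) x * w (lat M x) k x).
Proof.
move=> [oL _ _ hL1 hL] [oM aM _ hM1 hM] [oK _ _ hK1 hK] [ru hu] [rw hw].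
have ind i k x j j' : ldom i x -> ldom k x -> ldom j x -> ldom j' x ->
    u i j x * w j k x = u i j' x * w j' k x.
  move=> ix kx jx j'x.
  have := hw j j' k k x jx j'x kx kx; rewrite hK1 // mulr1 => ->.
  have := hu i i j j' x ix ix jx j'x; rewrite hL1 // mul1r => <-.
  by rewrite mulrA.
split=> [i k|i i' k k' x ix i'x kx k'x]; last first.
  rewrite -mulrA (hw _ (lat M x) k k' x) // hM1 // mul1r.
  by have := hu i i' (lat M x) (lat M x) x ix i'x (aM x) (aM x);
     rewrite hM1 // mulr1 => ->; rewrite mulrA.
apply: (reg_local hZ) => x [ix kx]; exists (ldom (lat M x)); split=> //.
set j := lat M x.
have o1 : zopen (ldom i `&` ldom k `&` ldom j).
  by apply: open_inter => //; apply: open_inter.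
apply: (reg_ext hZ o1 (f := fun y => u i j y * w j k y)).
  apply: reg_mul => //; [apply: reg_restrict (ru i j)|
    apply: reg_restrict (rw j k)] => //; by move=> y [[? ?] ?].
by move=> y [[iy ky] jy]; apply: ind.
Qed.

Lemma lhom_power Z (hZ : function_space Z) (L M : lbundle Z) u m :
  is_lbundle L -> is_lbundle M -> @lhom Z L M u ->
  @lhom Z (lpower L m) (lpower M m) (fun i j x => u i j x ^+ m).
Proof.
move=> [oL _ _ _ _] [oM _ _ _ _] [ru hu]; split=> [i j|i i' j j' x ix i'x jx j'x].
  have oij : zopen (ldom (l := L) i `&` ldom (l := M) j) by apply: open_inter.
  exact: (reg_exp hZ m oij (ru i j)).
by rewrite /= -!exprMn (hu i i' j j').
Qed.

Lemma lhom_pullback Y Z (hZ : function_space Z) (f : Y -> Z)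
  (L M : lbundle Z) u : morphism f ->
  is_lbundle L -> is_lbundle M -> @lhom Z L M u ->
  @lhom Y (lpullback f L) (lpullback f M) (fun i j y => u i j (f y)).
Proof.
move=> [_ rf] [oL _ _ _ _] [oM _ _ _ _] [ru hu]; split=> [i j|i i' j j' x].
  have oij : zopen (ldom (l := L) i `&` ldom (l := M) j) by apply: open_inter.
  exact: rf _ _ oij (ru i j).
by move=> *; apply: hu.
Qed.

Lemma is_lbundle_power Z (hZ : function_space Z) (L : lbundle Z) m :
  is_lbundle L -> is_lbundle (lpower L m).
Proof.
move=> [oL aL rL h1 h2]; split=> //=.
- move=> i j; have oij : zopen (ldom i `&` ldom j) by apply: open_inter.
  exact: (reg_exp hZ m oij (rL i j)).
- by move=> i x ix; rewrite h1 // expr1n.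
- by move=> i j k x ix jx kx; rewrite -exprMn h2.
Qed.

Lemma is_lbundle_pullback Y Z (hZ : function_space Z) (f : Y -> Z)
  (L : lbundle Z) : morphism f -> is_lbundle L -> is_lbundle (lpullback f L).
Proof.
move=> [of_ rf] [oL aL rL h1 h2]; split=> //=.
- by move=> i; apply: of_.
- move=> i j; have oij : zopen (ldom i `&` ldom j) by apply: open_inter.
  exact: rf _ _ oij (rL i j).
- by move=> i x; apply: h1.
- by move=> i j k x; apply: h2.
Qed.

Section Degree.
Variables (Z : Defs.space R) (hZ : function_space Z)
  (irr : irreducible_space Z).

(** Allowing any larger list than the support lets the divisors of several sections be summed over
    one common list. *)
Lemma divisor_degree_ord (L : lbundle Z) (W : set Z) s e :
  @divisor_degree R Z L W s e ->
  exists (o : Z -> int) (r : seq {classic Z}),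
    (forall p, order_at W s p (o p)) /\
    forall r' : seq {classic Z}, uniq r' -> {subset r <= r'} ->
      e = \sum_(p <- r') o p.
Proof.
move=> [k [p [v [pinj hv h0 ->]]]].
pose o (q : Z) : int :=
  if pselect (exists i, q = p i) is left h then v (sval (cid h)) else 0.
have op i : o (p i) = v i.
  rewrite /o; case: pselect => [h|h]; last by exfalso; apply: h; exists i.
  by case: cid => j /= /pinj ->.
pose r : seq {classic Z} := [seq (p i : {classic Z}) | i <- enum 'I_k].
exists o, r; split=> [q|r' ur' sr].
  rewrite /o; case: pselect => [h|h]; first by case: cid => j /= ->.
  by apply: h0 => i qi; apply: h; exists i.
have rr' : perm_eq [seq q <- r' | q \in r] r.
  apply: uniq_perm; first exact: filter_uniq.
    by rewrite map_inj_uniq ?enum_uniq // => i j /pinj.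
  move=> q; rewrite mem_filter; case qr: (q \in r) => //=.
  exact: sr.
rewrite (bigID (fun q => q \in r)) /= [X in _ = _ + X]big1 => [|q].
  rewrite addr0 -[RHS]big_filter (perm_big r) //= big_map big_enum /=.
  by apply: eq_bigr => i _; rewrite op.
move=> /negP nq; rewrite /o; case: pselect => // h.
by exfalso; apply: nq; case: h => i ->; apply: map_f; rewrite mem_enum.
Qed.

Lemma trivial_section (L : lbundle Z) (W : set Z) (i0 : lidx L) (phi : Z -> C) :
  is_lbundle L -> zopen W -> W `<=` ldom i0 -> regular W phi ->
  (exists2 x, W x & phi x != 0) ->
  rational_section W (fun i x => ltr i i0 x * phi x).
Proof.
move=> [oL aL rL h1 h2] oW Wi rphi [x Wx phix]; split=> //.
  split=> [i|i j y Wy iy jy]; last by rewrite mulrA h2 //; apply: Wi.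
  have oWi : zopen (W `&` ldom i) by apply: open_inter.
  apply: reg_mul => //; last by apply: reg_restrict rphi => // ? [].
  by apply: reg_restrict (rL i i0) => // y [Wy iy]; split=> //; apply: Wi.
by exists i0, x; split=> //; [apply: Wi|rewrite h1 ?mul1r //; apply: Wi].
Qed.

(** A finite dimensional local ring is a field here ([colength_artinian]), so nonzero a and b have
    colength 0. [order_at] also admits a = b = 0 as germs at such a point; both colengths are then
    k0 and cancel. No mixed case occurs, as s is nonzero on a dense open set. *)
Lemma order_at_artinian (L : lbundle Z) (W : set Z) s p v k0 : is_lbundle L ->
  colength p (fun=> 0) k0 -> @rational_section R Z L W s ->
  order_at W s p v -> v = 0.
Proof.
move=> [oL _ rL h1 h2] h0 [oW [rs ts] [i' [x' [Wx' ix' sx']]]].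
move=> [i [a [b [k [l [ip [ra rb] [ha hb] [V [oV Vp e]] ->]]]]]].
pose D := [set x | (W `&` ldom i') x /\ s i' x != 0] `&` ldom i.
have oD1 : zopen [set x | (W `&` ldom i') x /\ s i' x != 0].
  by apply: open_neq0 => //; apply: open_inter.
have oD : zopen D by apply: open_inter.
have D0 : D !=set0 by apply: irr => //; [exists x'|exists p].
have sD x : D x -> [/\ W x, ldom i x & s i x != 0].
  move=> [[[Wx i'x] sx] ix]; split=> //; apply: contraNN sx => /eqP s0.
  by rewrite (ts i' i) // s0 mulr0.
have r0 := regular_at_const hZ p 0.
have [a0|a0] := pselect (germ_eq p a (fun=> 0)).
  have b0 : germ_eq p b (fun=> 0).
    apply: (@dense_germ_eq _ _ hZ p irr D) => //.
    case: a0 => U [oU Up a0]; exists (U `&` V); split=> //.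
      exact: open_inter.
    move=> q [Uq Vq] /sD[Wq iq sq]; have := e q Vq Wq iq; rewrite a0 //.
    by move=> /eqP; rewrite mulf_eq0 (negPf sq) orbF => /eqP.
  rewrite (colength_uniq hZ (colength_germ hZ a0 ha) h0).
  by rewrite (colength_uniq hZ (colength_germ hZ b0 hb) h0) subrr.
have b0 : ~ germ_eq p b (fun=> 0).
  move=> [U [oU Up b0]]; apply: a0.
  apply: (@dense_germ_eq _ _ hZ p irr D) => //.
  exists (U `&` V); split=> //; first exact: open_inter.
  by move=> q [Uq Vq] /sD[Wq iq sq]; rewrite -e // b0 // mul0r.
rewrite (colength_artinian hZ irr ra a0 h0 ha).
by rewrite (colength_artinian hZ irr rb b0 h0 hb).
Qed.

(* For a section r of L on W the function phi = s i0 j0 gives a second one    *)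
(* phi r with the same degree, and s exhibits r^P (phi r) as a multiple of    *)
(* t^q; the order of r^P (phi r) is thus at least the order of t^q.           *)
Lemma degree_le_lhom (L M : lbundle Z) (P q : nat) s u v :
  is_lbundle L -> is_lbundle M ->
  @lhom Z (lpower L P.+1) (lpower M q) s ->
  (exists i j x, [/\ ldom (l := L) i x, ldom (l := M) j x & s i j x != 0]) ->
  degree L u -> degree M v -> q%:Z * v <= P.+1%:Z * u.
Proof.
move=> hL hM [rs ts] [i0 [j0 [x0 [ix0 jx0 sx0]]]] du dv.
have [oL _ rL hL1 hL2] := hL; have [oM _ rM hM1 hM2] := hM.
pose W : set Z := ldom (l := L) i0 `&` ldom (l := M) j0.
have oW : zopen W by apply: open_inter.
pose phi := s i0 j0.
have rphi : regular W phi by apply: rs.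
have sR := trivial_section (i0 := i0) hL oW (@subIsetl _ _ _) rphi
  (ex_intro2 _ _ x0 (conj ix0 jx0) sx0).
have one0 : exists2 x, W x & (1 : C) != 0.
  by exists x0 => //; apply: oner_neq0.
have sr := trivial_section (i0 := i0) hL oW (@subIsetl _ _ _)
  (reg_const hZ 1 oW) one0.
have st := trivial_section (i0 := j0) hM oW (@subIsetr _ _ _)
  (reg_const hZ 1 oW) one0.
have [o1 [l1 [ho1 hs1]]] := divisor_degree_ord (du _ _ sR).
have [o2 [l2 [ho2 hs2]]] := divisor_degree_ord (du _ _ sr).
have [o3 [l3 [ho3 hs3]]] := divisor_degree_ord (dv _ _ st).
suff key p : q%:Z * o3 p <= o1 p + P%:Z * o2 p.
  pose r := undup (l1 ++ l2 ++ l3).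
  have sub l : {subset l <= l1 ++ l2 ++ l3} -> {subset l <= r}.
    by move=> h x /h; rewrite mem_undup.
  have e1 : u = \sum_(p <- r) o1 p.
    apply: hs1; first exact: undup_uniq.
    by apply: sub => x xl; rewrite mem_cat xl.
  have e2 : u = \sum_(p <- r) o2 p.
    apply: hs2; first exact: undup_uniq.
    by apply: sub => x xl; rewrite !mem_cat xl orbT.
  have e3 : v = \sum_(p <- r) o3 p.
    apply: hs3; first exact: undup_uniq.
    by apply: sub => x xl; rewrite !mem_cat xl !orbT.
  (* u is counted once as the degree of phi r and P times as the degree of r. *)
  rewrite -addn1 PoszD mulrDl mul1r addrC {1}e1 e2 e3 !mulr_sumr -big_split /=.
  exact: ler_sum.
have [[k0 hk0]|nk0] := pselect (exists k0, colength p (fun=> 0) k0).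
  rewrite (order_at_artinian hL hk0 sR (ho1 p)).
  rewrite (order_at_artinian hL hk0 sr (ho2 p)).
  by rewrite (order_at_artinian hM hk0 st (ho3 p)) !mulr0 addr0.
(* The local ring now has infinite dimension, so a germ of finite colength is nonzero. *)
have nz f k : colength p f k -> ~ germ_eq p f (fun=> 0).
  by move=> hf f0; apply: nk0; exists k; apply: colength_germ f0 hf.
have [i1 [a1 [b1 [k1 [m1 [ip1 [ra1 rb1] [ha1 hb1] [V1 [oV1 Vp1 e1]] ->]]]]]] :=
  ho1 p.
have [i2 [a2 [b2 [k2 [m2 [ip2 [ra2 rb2] [ha2 hb2] [V2 [oV2 Vp2 e2]] ->]]]]]] :=
  ho2 p.
have [j3 [a3 [b3 [k3 [m3 [jp3 [ra3 rb3] [ha3 hb3] [V3 [oV3 Vp3 e3]] ->]]]]]] :=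
  ho3 p.
(* With phi r, r and t equal to a1/b1, a2/b2 and a3/b3 in the charts i1, i2 and j3, clearing
   denominators in r^P (phi r) = s(t^q) gives a1 a2^P b3^q = c b1 b2^P a3^q. *)
pose c x := ltr i1 i2 x * s i2 j3 x.
have rc : regular_at p c.
  apply: regular_at_mul => //.
    by exists (ldom i1 `&` ldom i2); split=> //; apply: open_inter.
  by exists (ldom (l := L) i2 `&` ldom (l := M) j3); split=> //;
    [apply: open_inter|apply: rs].
have rX f m := @regular_at_exp _ _ hZ p f m.
have rM2 f g := @regular_at_mul _ _ hZ p f g.
have n0X f m k : regular_at p f -> colength p f k ->
    ~ germ_eq p (fun x => f x ^+ m) (fun=> 0).
  by move=> rf /nz; apply: germ_exp_neq0.
have cX f m k : regular_at p f -> colength p f k ->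
    colength p (fun x => f x ^+ m) (m * k).
  by move=> rf hf; apply: colength_exp => //; apply: nz hf.
have hl : colength p (fun x => b1 x * (b2 x ^+ P * a3 x ^+ q))
    (m1 + (P * m2 + q * k3)).
  apply: colength_mul => //; [exact/rM2/rX/ra3/rX|exact: nz hb1|].
  by apply: colength_mul => //; [exact: rX|exact: rX|exact: n0X hb2|
    exact: cX|exact: cX].
have hr : colength p (fun x => a1 x * (a2 x ^+ P * b3 x ^+ q))
    (k1 + (P * k2 + q * m3)).
  apply: colength_mul => //; [exact/rM2/rX/rb3/rX|exact: nz ha1|].
  by apply: colength_mul => //; [exact: rX|exact: rX|exact: n0X ha2|
    exact: cX|exact: cX].
have : (m1 + (P * m2 + q * k3) <= k1 + (P * k2 + q * m3))%N.
  apply: (colength_dvd hZ rc _ hl hr).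
  (* The sections are defined on W only; density extends the identity to germs at p. *)
  apply: (@dense_germ_eq _ _ hZ p irr W) => //.
  - exact/rM2/rM2/rX/rb3/rX.
  - exact/rM2/rM2/rM2/rX/ra3/rX.
  - by exists x0.
  exists (V1 `&` V2 `&` V3 `&` (ldom i1 `&` ldom i2 `&` ldom j3)); split=> //.
    by do ! apply: open_inter => //.
  move=> x [[[V1x V2x] V3x] [[ix1 ix2] jx3]] Wx; have [ix jx] := Wx.
  rewrite -e1 // -e2 // -e3 // !mulr1 /c.
  have /= ts1 := ts i2 i0 j3 j0 x ix2 ix jx3 jx.
  rewrite -(hL2 i1 i2 i0) // !exprMn.
  transitivity (ltr i1 i2 x * b1 x * b2 x ^+ P * b3 x ^+ q *
    (ltr i2 i0 x ^+ P.+1 * s i0 j0 x)).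
    by rewrite exprS /phi; ring.
  by rewrite -ts1; ring.
rewrite -lez_nat !PoszD !PoszM; lia.
Qed.

End Degree.
End LineBundleDegree.

(** * Homogeneous polynomials *)

Section HomogeneousPolynomials.
Context {R : realType} {n : nat}.
Local Notation C := R[i].

Lemma homogeneousXU i : homogeneous 1 ('X_i : {mpoly C[n]}).
Proof. by rewrite /homogeneous dhomogX; apply/eqP; apply: mdeg1. Qed.

Lemma homogeneousX d (p : {mpoly C[n]}) m :
  homogeneous d p -> homogeneous (d * m) (p ^+ m).
Proof. by move=> h; rewrite /homogeneous dhomogMn. Qed.

Lemma homogeneous_prod (I : Type) (r : seq I) (p : I -> {mpoly C[n]})
  (d : I -> nat) :
  (forall i, homogeneous (d i) (p i)) ->
  homogeneous (\sum_(i <- r) d i) (\prod_(i <- r) p i).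
Proof.
move=> h; elim: r => [|i r IH]; first by rewrite !big_nil; apply: dhomog1.
by rewrite !big_cons; apply: dhomogM => //; apply: h.
Qed.

Lemma homogeneous_const (k : C) : homogeneous 0 (k%:MP : {mpoly C[n]}).
Proof. by rewrite /homogeneous -alg_mpolyC; apply: dhomogZ; apply: dhomog1. Qed.

Lemma homogeneous_comp k d (p : {mpoly C[k]}) (lq : k.-tuple {mpoly C[n]}) :
  homogeneous d p -> (forall i, homogeneous 1 (tnth lq i)) ->
  homogeneous d (p \mPo lq).
Proof.
move=> hp hlq; rewrite /homogeneous comp_mpolyE big_seq.
apply: rpred_sum => m mp; apply: dhomogZ.
have <- : (\sum_i 1 * m i)%N = d.
  under eq_bigr do rewrite mul1n.
  by rewrite -mdegE; exact: (dhomog_mf hp mp).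
by apply: homogeneous_prod => i; apply: homogeneousX.
Qed.

Lemma homogeneous_scale d (p : {mpoly C[n]}) (c : C) (v : 'I_n -> C) :
  homogeneous d p -> p.@[fun k => c * v k] = c ^+ d * p.@[v].
Proof.
move=> hp; rewrite !mevalE mulr_sumr !big_seq; apply: eq_bigr => m mp.
rewrite mulrCA; congr (_ * _); under eq_bigr do rewrite exprMn.
by rewrite big_split /= prodrXr -mdegE (dhomog_mf hp mp).
Qed.

Lemma homogeneous_msize d (p : {mpoly C[n]}) : homogeneous d p ->
  (msize p <= d.+1)%N.
Proof.
move=> hp; rewrite mmeasureE big_seq; apply/bigmax_leqP_seq => m mp _.
by rewrite (dhomog_mf hp mp).
Qed.

End HomogeneousPolynomials.

(** * Projective space as a space with functions, and its line bundles O(k) *)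

Section ProjectiveSpaceFunctions.
Context {R : realType} {N : nat}.
Local Notation C := R[i].
Local Notation P := (proj_space N : Defs.space R).
Local Notation poly := {mpoly C[N.+1]}.

Lemma hevalM (p q : poly) (x : @lines R N.+1) :
  heval (p * q) x = heval p x * heval q x.
Proof. exact: mevalM. Qed.

Lemma hevalD (p q : poly) (x : @lines R N.+1) :
  heval (p + q) x = heval p x + heval q x.
Proof. exact: mevalD. Qed.

Lemma hevalXU i (x : @lines R N.+1) : heval ('X_i : poly) x = hcoord x 0 i.
Proof. exact: mevalXU. Qed.

Lemma hevalX (p : poly) m (x : @lines R N.+1) : heval (p ^+ m) x = heval p x ^+ m.
Proof. exact: rmorphXn. Qed.

Lemma heval_prod (I : Type) (r : seq I) (p : I -> poly) (x : @lines R N.+1) :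
  heval (\prod_(i <- r) p i) x = \prod_(i <- r) heval (p i) x.
Proof. exact: rmorph_prod. Qed.

Lemma heval1 (x : @lines R N.+1) : heval (1 : poly) x = 1.
Proof. exact: meval1. Qed.

Lemma proj_space_openP (U : set P) : zopen U <->
  forall x, U x -> exists (r : poly) (e : nat), [/\ homogeneous e r,
    heval r x != 0 & forall y, heval r y != 0 -> U y].
Proof.
split=> [[S [hS ->]] x /= [r Sr rx]|h].
  by have [e he] := hS r Sr; exists r, e; split=> // y ry; exists r.
exists [set r : poly | (exists e, homogeneous e r) /\
                       forall y, heval r y != 0 -> U y]; split=> [p []//|].
apply/seteqP; split=> x /= => [/h[r [e [he rx rU]]]|[r [_ rU] /rU//]].
by exists r => //; split=> //; exists e.
Qed.

Lemma proj_space_regularP (U : set P) (f : P -> C) : regular U f <->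
  forall x, U x -> exists (r : poly) (e d : nat) (p q : poly),
    [/\ homogeneous e r, heval r x != 0, homogeneous d p, homogeneous d q &
        forall y, heval r y != 0 ->
          [/\ U y, heval q y != 0 & f y = heval p y / heval q y]].
Proof.
split=> [h x /h [S [d [p [q [hS [[r Sr rx] VU] hp hq e]]]]]|h x /h].
  have [i hi] := hS r Sr; exists r, i, d, p, q; split=> // y ry.
  have Vy : exists2 r, S r & heval r y != 0 by exists r.
  by have [] := e y Vy; split=> //; apply: VU.
move=> [r [i [d [p [q [hr rx hp hq e]]]]]].
exists [set r], d, p, q; split=> //= [_ ->||y]; first by exists i.
  by split=> [|y [_ -> /e[]//]]; exists r.
by move=> [_ -> /e[]].
Qed.

Lemma function_space_proj_space : function_space P.
Proof.
(* Sums and products are treated together: it suffices to write the result over the common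
   denominator q q'. *)
have main (U : set P) f g (op : C -> C -> C) : zopen U -> regular U f ->
    regular U g ->
    (forall (d d' : nat) (p q p' q' : poly), homogeneous d p ->
      homogeneous d q -> homogeneous d' p' -> homogeneous d' q' ->
      exists p'' : poly, homogeneous (d + d') p'' /\ forall y : @lines R N.+1,
        heval q y != 0 -> heval q' y != 0 ->
        op (heval p y / heval q y) (heval p' y / heval q' y) =
        heval p'' y / heval (q * q') y) ->
    regular U (fun x => op (f x) (g x)).
  move=> _ /proj_space_regularP rf /proj_space_regularP rg h.
  apply/proj_space_regularP => x Ux.
  have [r [e [d [p [q [hr rx hp hq efx]]]]]] := rf x Ux.
  have [r' [e' [d' [p' [q' [hr' rx' hp' hq' egx]]]]]] := rg x Ux.
  have [p'' [hp'' ep]] := h d d' p q p' q' hp hq hp' hq'.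
  exists (r * r'), (e + e')%N, (d + d')%N, p'', (q * q'); split=> //.
  - exact: dhomogM.
  - by rewrite hevalM mulf_neq0.
  - exact: dhomogM.
  move=> y; rewrite hevalM mulf_eq0 negb_or => /andP[ry r'y].
  have [Uy qy ->] := efx y ry; have [_ q'y ->] := egx y r'y.
  by split=> //; [rewrite hevalM mulf_neq0|rewrite ep].
split.
- apply/proj_space_openP => x _; exists 1, 0%N; split=> //.
    exact: dhomog1.
  by rewrite heval1 oner_neq0.
- move=> U V /proj_space_openP oU /proj_space_openP oV.
  apply/proj_space_openP => x [Ux Vx].
  have [r [e [hr rx rU]]] := oU x Ux; have [s [d [hs sx sV]]] := oV x Vx.
  exists (r * s), (e + d)%N; split; first exact: dhomogM.
    by rewrite hevalM mulf_neq0.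
  move=> y; rewrite hevalM mulf_eq0 negb_or => /andP[ry sy].
  by split; [apply: rU|apply: sV].
- move=> U h; apply/proj_space_openP => x /h [V [/proj_space_openP oV Vx VU]].
  have [r [e [hr rx rV]]] := oV x Vx; exists r, e; split=> // y /rV; exact: VU.
- move=> U k /proj_space_openP oU; apply/proj_space_regularP => x Ux.
  have [r [e [hr rx rU]]] := oU x Ux.
  exists r, e, 0%N, (k%:MP), 1; split=> //.
  + exact: homogeneous_const.
  + exact: dhomog1.
  move=> y ry; split; first exact: rU.
    by rewrite heval1 oner_neq0.
  by rewrite heval1 divr1 /heval mevalC.
- move=> U f g oU rf rg; apply: main oU rf rg _.
  move=> d d' p q p' q' hp hq hp' hq'; exists (p * q' + p' * q); split.
    apply: dhomogD; first exact: dhomogM.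
    by rewrite addnC; apply: dhomogM.
  by move=> y qy q'y; rewrite hevalD !hevalM addf_div.
- move=> U f g oU rf rg; apply: main oU rf rg _.
  move=> d d' p q p' q' hp hq hp' hq'; exists (p * p'); split.
    exact: dhomogM.
  by move=> y qy q'y; rewrite !hevalM mulf_div.
- move=> U f _ /proj_space_regularP rf f0; apply/proj_space_regularP => x Ux.
  have [r [e [d [p [q [hr rx hp hq efx]]]]]] := rf x Ux.
  exists r, e, d, q, p; split=> // y /efx [Uy qy fy]; split=> //.
    by apply: contraNN (f0 y Uy) => /eqP py; rewrite fy py mul0r.
  by rewrite fy invf_div.
- move=> U V f g /proj_space_openP oV VU /proj_space_regularP rf fg.
  apply/proj_space_regularP => x Vx.
  have [r [e [d [p [q [hr rx hp hq efx]]]]]] := rf x (VU x Vx).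
  have [s [i [hs sx sV]]] := oV x Vx.
  exists (r * s), (e + i)%N, d, p, q; split=> //; first exact: dhomogM.
    by rewrite hevalM mulf_neq0.
  move=> y; rewrite hevalM mulf_eq0 negb_or => /andP[ry sy].
  have [Uy qy fy] := efx y ry; split=> //; first exact: sV.
  by rewrite -fg //; apply: sV.
- move=> U f h; apply/proj_space_regularP => x Ux.
  have [V [oV Vx /proj_space_regularP rf]] := h x Ux.
  have [r [e [d [p [q [hr rx hp hq efx]]]]]] := rf x (conj Ux Vx).
  by exists r, e, d, p, q; split=> // y /efx [[]].
- move=> U f _ /proj_space_regularP rf; apply/proj_space_openP => x [Ux fx].
  have [r [e [d [p [q [hr rx hp hq efx]]]]]] := rf x Ux.
  have px : heval p x != 0.
    have [_ _ efx'] := efx x rx.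
    by apply: contraNN fx => /eqP p0; rewrite efx' p0 mul0r.
  exists (r * p), (e + d)%N; split; first exact: dhomogM.
    by rewrite hevalM mulf_neq0.
  move=> y; rewrite hevalM mulf_eq0 negb_or => /andP[ry py].
  have [Uy qy fy] := efx y ry; split=> //=.
  by rewrite fy mulf_neq0 // invr_eq0.
Qed.

Lemma basic_open (r : poly) e : homogeneous e r ->
  zopen ([set x | heval r x != 0] : set P).
Proof.
by move=> hr; apply/proj_space_openP => x /= rx; exists r, e.
Qed.

Lemma hcoord_open i : zopen ([set x : @lines R N.+1 | hcoord x 0 i != 0] : set P).
Proof.
have := basic_open (homogeneousXU i); congr zopen.
by apply/seteqP; split=> x /=; rewrite hevalXU.
Qed.

Lemma fraction_regular (U : set P) d (p q : poly) : zopen U ->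
  homogeneous d p -> homogeneous d q -> (forall x, U x -> heval q x != 0) ->
  regular U (fun x => heval p x / heval q x).
Proof.
move=> /proj_space_openP oU hp hq q0; apply/proj_space_regularP => x Ux.
have [r [e [hr rx rU]]] := oU x Ux.
exists r, e, d, p, q; split=> // y /rU Uy; split=> //; exact: q0.
Qed.

Lemma hcoord_ratio_regular (U : set P) (i j : 'I_N.+1) : zopen U ->
  (forall x : @lines R N.+1, U x -> hcoord x 0 i != 0) ->
  regular U (fun x : @lines R N.+1 => hcoord x 0 j / hcoord x 0 i).
Proof.
move=> oU U0; have h x : U x -> heval ('X_i : poly) x != 0.
  by move=> Ux; rewrite hevalXU U0.
apply: (reg_ext function_space_proj_space oU
  (fraction_regular oU (homogeneousXU j) (homogeneousXU i) h)) => x _.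
by rewrite !hevalXU.
Qed.

Lemma is_lbundle_O_P k : is_lbundle (@O_P R N k).
Proof.
have hP := function_space_proj_space.
split=> /=.
- exact: hcoord_open.
- by move=> x; apply: (xchooseP (hcoord_neq0 x)).
- move=> i j.
  have oij : zopen ([set x : @lines R N.+1 | hcoord x 0 i != 0] `&`
      [set x : @lines R N.+1 | hcoord x 0 j != 0] : set P).
    exact: (open_inter hP (hcoord_open i) (hcoord_open j)).
  have rij : regular _ _ := hcoord_ratio_regular j oij (fun x h => h.1).
  have rji : regular _ _ := hcoord_ratio_regular i oij (fun x h => h.2).
  case: k => k; first exact: (reg_exp hP k oij rij).
  apply: (reg_ext hP oij (reg_exp hP k.+1 oij rji)) => x _.
  by rewrite NegzE -exprnN -exprVn invf_div.
- by move=> i x ix; rewrite divff // exp1rz.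
- move=> i j l x ix jx lx; rewrite -expfzMl.
  by congr (_ ^ _); rewrite mulrC mulrA divfK.
Qed.

End ProjectiveSpaceFunctions.

(** * Dickson's lemma and Noetherianity *)

Section HilbertBasis.

(** Induction on k. Let l serve the first k coordinates and let B bound the next one on l. Elements
    whose next coordinate is at least B are dominated by l; the others take finitely many values
    there, and the induction hypothesis serves each value. *)
Lemma dickson (T : eqType) k (m : T -> nat -> nat) (S : set T) :
  exists l : seq T, {in l, forall t, S t} /\
    forall t, S t -> exists2 t', t' \in l &
      forall j, (j < k)%N -> (m t' j <= m t j)%N.
Proof.
elim: k S => [|k IH] S.
  have [[t St]|S0] := pselect (exists t, S t).
    exists [:: t]; split=> [t'|t' _]; first by rewrite inE => /eqP ->.
    by exists t => //; rewrite inE.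
  by exists [::]; split=> // t St; exfalso; apply: S0; exists t.
have [l [lS hl]] := IH S.
pose B := \max_(t <- l) m t k.
have [l' [l'S hl']] : exists l' : seq T, {in l', forall t, S t} /\
    forall t, S t -> (m t k < B)%N -> exists2 t', t' \in l' &
      forall j, (j < k.+1)%N -> (m t' j <= m t j)%N.
  elim: B => [|b [l1 [l1S hl1]]]; first by exists [::].
  have [l2 [l2S hl2]] := IH [set t | S t /\ m t k = b].
  exists (l1 ++ l2); split=> [t|t St].
    by rewrite mem_cat => /orP[/l1S|/l2S []].
  rewrite ltnS leq_eqVlt => /orP[/eqP mt|mt].
    have [t' t'2 ht'] := hl2 t (conj St mt).
    exists t'; first by rewrite mem_cat t'2 orbT.
    move=> j; rewrite ltnS leq_eqVlt => /orP[/eqP ->|]; last exact: ht'.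
    by rewrite mt; case: (l2S t' t'2) => _ ->.
  have [t' t'1 ht'] := hl1 t St mt; exists t' => //.
  by rewrite mem_cat t'1.
exists (l' ++ l); split=> [t|t St].
  by rewrite mem_cat => /orP[/l'S|/lS].
have [mB|Bm] := ltnP (m t k) B.
  have [t' t'1 ht'] := hl' t St mB; exists t' => //.
  by rewrite mem_cat t'1.
have [t' t'l ht'] := hl t St; exists t'; first by rewrite mem_cat t'l orbT.
move=> j; rewrite ltnS leq_eqVlt => /orP[/eqP ->|]; last exact: ht'.
by apply: leq_trans Bm; exact: (@leq_bigmax_seq _ l xpredT (m ^~ k) t').
Qed.

Definition ideal (K : fieldType) n (S : set {mpoly K[n]}) : set {mpoly K[n]} :=
  [set p | exists (l : seq ({mpoly K[n]} * {mpoly K[n]})),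
     {in l, forall x, S x.2} /\ p = \sum_(x <- l) x.1 * x.2].

Lemma ideal_sub_mul (K : fieldType) n (S : set {mpoly K[n]}) p q g :
  ideal S p -> ideal S g -> ideal S (p - q * g).
Proof.
move=> [l [lS ->]] [l' [l'S ->]].
exists (l ++ [seq (- q * x.1, x.2) | x <- l']); split.
  move=> x; rewrite mem_cat => /orP[/lS //|/mapP[y yl' ->]] /=; exact: l'S.
rewrite big_cat /= big_map mulr_sumr -sumrN; congr (_ + _).
by apply: eq_bigr => x _; rewrite /= !mulNr mulrA.
Qed.

(** By [dickson] on leading monomials, a finite part G of the ideal generated by S has leading
    monomials that divide all others. Cancelling leading terms reduces every element of the ideal by
    G, so zeros of G are zeros of S; and each member of G involves finitely many members of S. *)
Lemma common_zeros_finite (K : fieldType) n (S : set {mpoly K[n]}) :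
  exists l : seq {mpoly K[n]}, {in l, forall q, S q} /\
    forall v, {in l, forall q, q.@[v] = 0} -> forall q, S q -> q.@[v] = 0.
Proof.
pose m (p : {mpoly K[n]}) (j : nat) : nat :=
  if insub j is Some i then mlead p i else 0%N.
have mE p (i : 'I_n) : m p i = mlead p i by rewrite /m valK.
have [G [GI hG]] := dickson n m [set p | ideal S p /\ p != 0].
have gen v : {in G, forall g, g.@[v] = 0} -> forall p, ideal S p -> p.@[v] = 0.
  move=> G0; elim/mleadrect => p IH Ip.
  have [->|p0] := eqVneq p 0; first exact: meval0.
  have [g gG hg] := hG p (conj Ip p0); have [Ig g0] := GI g gG.
  have le : (mlead g <= mlead p)%MM.
    by apply/mnm_lepP => i; rewrite -!mE hg.
  pose c := mleadc p / mleadc g.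
  pose q := c *: 'X_[mlead p - mlead g] : {mpoly K[n]}.
  have gc0 : mleadc g != 0 by rewrite mleadc_eq0.
  have c0 : c != 0 by rewrite mulf_neq0 ?invr_eq0 // mleadc_eq0.
  have cq : mleadc q = c by rewrite mleadcZE mleadXm mcoeffX eqxx mulr1.
  have q0 : q != 0 by rewrite -mleadc_eq0 cq.
  have lq : mlead q = (mlead p - mlead g)%MM by rewrite mleadZ // mleadXm.
  have lqg : mlead (q * g) = mlead p by rewrite mleadM // lq submK.
  have cqg : (q * g)@_(mlead p) = mleadc p.
    rewrite -{1}lqg mleadcM_proper; last by rewrite cq mulf_neq0.
    by rewrite cq divfK.
  have Ir := ideal_sub_mul q Ip Ig.
  have -> : p = (p - q * g) + q * g by rewrite subrK.
  rewrite mevalD mevalM (G0 g gG) mulr0 addr0.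
  have [->|r0] := eqVneq (p - q * g) 0; first exact: meval0.
  apply: IH => //; rewrite lt_neqAle; apply/andP; split.
    apply/eqP => e; move: r0; rewrite -mleadc_eq0 e mcoeffB cqg subrr.
    by rewrite eqxx.
  by apply: le_trans (mleadB_le _ _) _; rewrite lqg joinxx.
have [L [LS hL]] : exists L : seq {mpoly K[n]}, {in L, forall q, S q} /\
    forall v, {in L, forall q, q.@[v] = 0} -> {in G, forall g, g.@[v] = 0}.
  have {}GI : {in G, forall g, ideal S g} by move=> g /GI[].
  clear hG gen.
  elim: G GI => [|g G IH] GI; first by exists [::].
  have [|L [LS hL]] := IH; first by move=> q qG; apply: GI; rewrite inE qG orbT.
  have [l [lS eg]] := GI g (mem_head _ _).
  exists ([seq x.2 | x <- l] ++ L); split=> [q|v L0 q].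
    by rewrite mem_cat => /orP[/mapP[x /lS ? ->] //|/LS].
  rewrite inE => /orP[/eqP ->|]; last first.
    by apply: hL => {}q qL; apply: L0; rewrite mem_cat qL orbT.
  rewrite eg raddf_sum big_seq big1 // => x xl /=.
  by rewrite mevalM (L0 x.2) ?mulr0 // mem_cat map_f.
exists L; split=> // v L0 q Sq; apply: (gen v (hL v L0)).
exists [:: (1, q)]; split; last by rewrite big_seq1 mul1r.
by move=> x; rewrite inE => /eqP ->.
Qed.

End HilbertBasis.

(** * Vector bundles and their twists *)

Section VectorBundles.
Context {R : realType}.
Local Notation C := R[i].

Record vector_bundle (Z : Defs.space R) (E : vbundle Z) : Prop := VectorBundle {
  vdom_open : forall i : vidx E, zopen (vdom i);
  vat_dom : forall x, vdom (vat E x) x;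
  vtr_regular : forall (i j : vidx E) k l,
    regular (vdom i `&` vdom j) (fun x => vtr i j x k l);
  vtr_id : forall (i : vidx E) x, vdom i x -> vtr i i x = 1%:M;
  vtr_cocycle : forall (i j k : vidx E) x, vdom i x -> vdom j x -> vdom k x ->
    vtr i j x *m vtr j k x = vtr i k x }.

Lemma vector_bundle_twist (Z : Defs.space R) (hZ : function_space Z)
  (E : vbundle Z) (L : lbundle Z) :
  vector_bundle E -> is_lbundle L -> vector_bundle (vtwist E L).
Proof.
move=> [oE aE rE h1 h2] [oL aL rL l1 l2]; split=> /=.
- by move=> i; apply: open_inter.
- by move=> x; split.
- move=> i j k l.
  have oij : zopen ((vdom i.1 `&` ldom i.2) `&` (vdom j.1 `&` ldom j.2)).
    by do 2! apply: open_inter => //.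
  apply: (reg_ext hZ oij (f := fun x => ltr i.2 j.2 x * vtr i.1 j.1 x k l)).
    by apply: reg_mul => //; [apply: reg_restrict (rL i.2 j.2)
      |apply: reg_restrict (rE i.1 j.1 k l)] => // x [[? ?] [? ?]].
  by move=> x _; rewrite mxE.
- by move=> i x [ix lx]; rewrite h1 // l1 // scale1r.
- move=> i j k x [ix lix] [jx ljx] [kx lkx].
  by rewrite -scalemxAl -scalemxAr scalerA h2 // l2.
Qed.

(** * The cotangent bundle of a smooth space *)

Section Cotangent.
Variables (Z : Defs.space R) (hZ : function_space Z).

Section MaximalIdeal.
Variable p : Z.
Implicit Types f g : Z -> C.

Lemma max_ideal_sq_ext f g : (forall q, f q = g q) ->
  in_max_ideal_sq p f -> in_max_ideal_sq p g.
Proof.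
move=> e [k [a [b [ha hb [U [oU Up h]]]]]]; exists k, a, b; split=> //.
by exists U; split=> // q /h; rewrite e.
Qed.

Lemma max_ideal_sq0 : in_max_ideal_sq p (fun=> 0).
Proof.
exists 0%N, (fun _ _ => 0), (fun _ _ => 0); split=> [[]//|[]//|].
by apply: (germ_eqP hZ) => q; rewrite big_ord0.
Qed.

Lemma max_ideal_sq_add f g : in_max_ideal_sq p f -> in_max_ideal_sq p g ->
  in_max_ideal_sq p (fun q => f q + g q).
Proof.
move=> [k [a [b [ha hb hf]]]] [l [c [d [hc hd hg]]]].
pose sum (u : 'I_k -> Z -> C) (v : 'I_l -> Z -> C) (i : 'I_(k + l)) :=
  match fintype.split i with inl j => u j | inr j => v j end.
exists (k + l)%N, (sum a c), (sum b d); split.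
- by move=> i; rewrite /sum; case: (fintype.split i).
- by move=> i; rewrite /sum; case: (fintype.split i).
apply: (germ_eq2 hZ hf hg) => q -> ->; rewrite big_split_ord /=.
congr (_ + _); apply: eq_bigr => i _.
  by rewrite /sum (unsplitK (inl i)).
by rewrite /sum (unsplitK (inr i)).
Qed.

Lemma max_ideal_sq_scale (c : C) f : in_max_ideal_sq p f ->
  in_max_ideal_sq p (fun q => c * f q).
Proof.
move=> [k [a [b [ha hb [U [oU Up h]]]]]].
exists k, (fun j q => c * a j q), b; split=> //.
  move=> j; have [ra ->] := ha j; rewrite mulr0; split=> //.
  by apply: regular_at_mul => //; apply: regular_at_const.
exists U; split=> // q /h ->; rewrite mulr_sumr.
by apply: eq_bigr => j _; rewrite mulrA.
Qed.

Lemma max_ideal_sq_lincomb k (c : 'I_k -> C) (f : 'I_k -> Z -> C) :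
  (forall j, in_max_ideal_sq p (f j)) ->
  in_max_ideal_sq p (fun q => \sum_j c j * f j q).
Proof.
move=> hf; elim: (index_enum _) => [|j r IH].
  by apply: max_ideal_sq_ext max_ideal_sq0 => q; rewrite big_nil.
apply: max_ideal_sq_ext (max_ideal_sq_add (max_ideal_sq_scale (c j) (hf j)) IH).
by move=> q; rewrite big_cons.
Qed.

(** The chain rule, with A as Jacobian matrix: substitute the expansions of the dt'_j in m / m^2. *)
Lemma differential_eq_trans m n (t : 'I_n -> Z -> C) (t' : 'I_m -> Z -> C) f
    (A : 'M[C]_(m, n)) b :
  (forall j, differential_eq t p (t' j) (row j A)) ->
  differential_eq t' p f b -> differential_eq t p f (b *m A).
Proof.
move=> hA hb.
have := max_ideal_sq_add hb (max_ideal_sq_lincomb (b 0) hA).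
apply: max_ideal_sq_ext => q.
under [X in _ + X]eq_bigr => j _.
  under eq_bigr do rewrite mxE.
  rewrite mulrBr; over.
rewrite sumrB addrA subrK; congr (_ - _).
under eq_bigr do rewrite mulr_sumr.
rewrite exchange_big /=; apply: eq_bigr => k _.
by rewrite mxE mulr_suml; apply: eq_bigr => j _; rewrite mulrA.
Qed.

Lemma differential_eq_coord n (t : 'I_n -> Z -> C) l :
  differential_eq t p (t l) (delta_mx 0 l).
Proof.
apply: max_ideal_sq_ext max_ideal_sq0 => q.
rewrite (bigD1 l) //= big1 ?addr0 => [|k kl].
  by rewrite mxE !eqxx mul1r subrr.
by rewrite mxE (negPf kl) andbF mul0r.
Qed.

End MaximalIdeal.

(** [partials] is chosen point by point; the uniqueness in [coordinates] identifies it with the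
    regular coefficients given there. *)
Lemma partialsP n (U V : set Z) (t : 'I_n -> Z -> C) f :
  coordinates U t -> zopen V -> V `<=` U -> regular V f ->
  (forall k, regular V (fun p => partials t p f 0 k)) /\
  forall p, V p -> forall a, differential_eq t p f a <-> a = partials t p f.
Proof.
move=> [oU rt h] oV VU rf; have [e [re he]] := h V f oV VU rf.
have eE p : V p -> partials t p f = e p.
  move=> Vp; rewrite /partials; case: pselect => [hp|hp].
    by case: cid => a /= /(he p Vp).
  by exfalso; apply: hp; exists (e p); apply/(he p Vp).
split=> [k|p Vp a]; last by rewrite eE //; apply: he.
by apply: (reg_ext hZ oV (re k)) => p Vp; rewrite eE.
Qed.

(** The cocycle rule is the chain rule together with uniqueness of partial derivatives. An index
    that is not a coordinate system has an empty chart. *)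
Lemma vector_bundle_cotangent n : smooth n Z -> vector_bundle (cotangent n Z).
Proof.
move=> sZ.
pose idx := (set Z * ('I_n -> Z -> C))%type.
pose dom (i : idx) : set Z := [set x | coordinates i.1 i.2 /\ i.1 x].
have odom i : zopen (dom i).
  by apply: (open_local hZ) => x [ci ix]; exists i.1; split=> //; case: ci.
have rdom i j l : coordinates i.1 i.2 -> regular (dom i `&` dom j) (j.2 l).
  move=> ci; apply: (reg_local hZ) => x [[_ ix] [cj jx]].
  have [oj rj _] := cj; exists j.1; split=> //.
  have o := open_inter hZ (open_inter hZ (odom i) (odom j)) oj.
  by apply: reg_restrict (rj l) => // y [].
have hp i j l := fun ci => partialsP ci (open_inter hZ (odom i) (odom j))
  (fun x h => h.1.2) (rdom i j l ci).
split=> /=.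
- exact: odom.
- move=> x; case: pselect => [h|h]; first by case: cid.
  by exfalso; apply: h; have [U [t [ct Ux]]] := sZ x; exists (U, t).
- move=> i j k l.
  have [ci|nci] := pselect (coordinates i.1 i.2); last first.
    apply: (reg_local hZ) => x [[ci _] _]; by exfalso.
  have [/(_ k) r _] := hp i j l ci.
  have oij := open_inter hZ (odom i) (odom j).
  by apply: (reg_ext hZ oij r) => x _; rewrite mxE.
- move=> i x ix; apply/matrixP => k l; rewrite !mxE.
  have [_ /(_ x (conj ix ix)) h] := hp i i l ix.1.
  by have /h <- := differential_eq_coord x i.2 l; rewrite mxE eqxx.
- move=> i j k x ix jx kx; apply/matrixP => a b.
  have [_ /(_ x (conj ix kx)) h] := hp i k b ix.1.
  rewrite [RHS]mxE.
  pose A := \matrix_(c < n, d < n) partials i.2 x (j.2 c) 0 d.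
  have hA c : differential_eq i.2 x (j.2 c) (row c A).
    have [_ /(_ x (conj ix jx)) hc] := hp i j c ix.1.
    by apply/hc; apply/rowP => d; rewrite !mxE.
  have hb : differential_eq j.2 x (k.2 b) (partials j.2 x (k.2 b)).
    have [_ /(_ x (conj jx kx)) hc] := hp j k b jx.1.
    exact/hc.
  have /h <- := differential_eq_trans hA hb.
  by rewrite !mxE; apply: eq_bigr => c _; rewrite !mxE mulrC.
Qed.

End Cotangent.

(** * The projective bundle P(E), its projection and O(1) *)

Section ProjectiveBundle.
Variables (Z : Defs.space R) (hZ : function_space Z).

Section SymSection.
Variable n : nat.

Definition coef_regular (U : set Z) (Q : Z -> {mpoly C[n]}) : Prop :=
  forall mu : 'X_{1..n}, regular U (fun x => (Q x)@_mu).

Variables (U : set Z) (oU : zopen U).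
Implicit Types P Q : Z -> {mpoly C[n]}.

Lemma coef_regular_ext P Q : coef_regular U P -> (forall x, U x -> P x = Q x) ->
  coef_regular U Q.
Proof. by move=> hP e mu; apply: (reg_ext hZ oU (hP mu)) => x /e ->. Qed.

Lemma coef_regular_const (p : {mpoly C[n]}) : coef_regular U (fun=> p).
Proof. by move=> mu; apply: reg_const. Qed.

Lemma coef_regular_add P Q : coef_regular U P -> coef_regular U Q ->
  coef_regular U (fun x => P x + Q x).
Proof.
move=> hP hQ mu; apply: (reg_ext hZ oU (reg_add hZ oU (hP mu) (hQ mu))) => x _.
by rewrite mcoeffD.
Qed.

Lemma coef_regular_mul P Q : coef_regular U P -> coef_regular U Q ->
  coef_regular U (fun x => P x * Q x).
Proof.
move=> hP hQ mu; pose I := 'X_{1..n < (mdeg mu).+1, (mdeg mu).+1}.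
apply: (reg_ext hZ oU (f := fun x => \sum_(k : I | mu == (k.1 + k.2)%MM)
    (P x)@_k.1 * (Q x)@_k.2)); last by move=> x _; rewrite mcoeffM.
apply: (@reg_sum _ _ hZ U I _ _ (fun k x => (P x)@_k.1 * (Q x)@_k.2)) => //.
by move=> k _; apply: reg_mul.
Qed.

Lemma coef_regular_scale f Q : regular U f -> coef_regular U Q ->
  coef_regular U (fun x => f x *: Q x).
Proof.
move=> rf hQ mu; apply: (reg_ext hZ oU (reg_mul hZ oU rf (hQ mu))) => x _.
by rewrite mcoeffZ.
Qed.

Lemma coef_regular_sum (I : Type) (r : seq I) (F : I -> Z -> {mpoly C[n]}) :
  (forall i, coef_regular U (F i)) ->
  coef_regular U (fun x => \sum_(i <- r) F i x).
Proof.
move=> hF; elim: r => [|i r IH].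
  by apply: coef_regular_ext (coef_regular_const 0) _ => x _; rewrite big_nil.
apply: coef_regular_ext (coef_regular_add (hF i) IH) _ => x _.
by rewrite big_cons.
Qed.

Lemma coef_regular_prod (I : Type) (r : seq I) (F : I -> Z -> {mpoly C[n]}) :
  (forall i, coef_regular U (F i)) ->
  coef_regular U (fun x => \prod_(i <- r) F i x).
Proof.
move=> hF; elim: r => [|i r IH].
  by apply: coef_regular_ext (coef_regular_const 1) _ => x _; rewrite big_nil.
apply: coef_regular_ext (coef_regular_mul (hF i) IH) _ => x _.
by rewrite big_cons.
Qed.

Lemma coef_regular_exp P m : coef_regular U P -> coef_regular U (fun x => P x ^+ m).
Proof.
move=> hP; elim: m => [|m IH]; first exact: coef_regular_const.
by apply: coef_regular_ext (coef_regular_mul hP IH) _ => x _; rewrite exprS.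
Qed.

(** The common degree d lets the composite be expanded over a finite set of monomials that does not
    depend on x. *)
Lemma coef_regular_comp k d (Q : Z -> {mpoly C[k]})
    (F : 'I_k -> Z -> {mpoly C[n]}) :
  (forall mu, regular U (fun x => (Q x)@_mu)) ->
  (forall x, U x -> homogeneous d (Q x)) ->
  (forall i, coef_regular U (F i)) ->
  coef_regular U (fun x => Q x \mPo [tuple F i x | i < k]).
Proof.
move=> rQ hQ hF; apply: (@coef_regular_ext (fun x =>
  \sum_(m : 'X_{1..k < d.+1}) (Q x)@_m *: \prod_(i < k) F i x ^+ m i)).
  apply: (@coef_regular_sum _ _ (fun (m : 'X_{1..k < d.+1}) x => (Q x)@_m *:
    \prod_(i < k) F i x ^+ m i)) => m; apply: coef_regular_scale => //.
  by apply: coef_regular_prod => i; apply: coef_regular_exp.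
move=> x Ux; rewrite (comp_mpolywE _ (homogeneous_msize (hQ x Ux))).
apply: eq_bigr => m _; congr (_ *: _); apply: eq_bigr => i _.
by rewrite tnth_mktuple.
Qed.

End SymSection.

Variables (E : vbundle Z) (hE : vector_bundle E).
Let n := vrank E.
Implicit Types (U : set Z) (Q : Z -> {mpoly C[n]}) (W : set (proj_pt E)).

Lemma sym_section_restrict U V m Q : zopen V -> V `<=` U ->
  sym_section U m Q -> sym_section V m Q.
Proof.
move=> oV VU [hQ rQ]; split=> [x /VU|mu]; first exact: hQ.
exact: (reg_restrict hZ oV VU (rQ mu)).
Qed.

Lemma sym_section_const U m (q : {mpoly C[n]}) : zopen U -> homogeneous m q ->
  sym_section U m (fun=> q).
Proof. by move=> oU hq; split=> // mu; apply: reg_const. Qed.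

Lemma sym_section_fun U f : zopen U -> regular U f ->
  @sym_section _ _ E U 0 (fun x => (f x)%:MP).
Proof.
move=> oU rf; split=> [x Ux|mu]; first exact: homogeneous_const.
apply: (reg_ext hZ oU
  (coef_regular_scale oU rf (coef_regular_const oU (1 : {mpoly C[n]})) mu)).
by move=> x _; rewrite alg_mpolyC.
Qed.

Lemma sym_section_add U m P Q : zopen U -> sym_section U m P ->
  sym_section U m Q -> sym_section U m (fun x => P x + Q x).
Proof.
move=> oU [hP rP] [hQ rQ]; split; last exact: coef_regular_add.
by move=> x Ux; apply: dhomogD; [apply: hP|apply: hQ].
Qed.

Lemma sym_section_mul U m m' P Q : zopen U -> sym_section U m P ->
  sym_section U m' Q -> sym_section U (m + m') (fun x => P x * Q x).
Proof.
move=> oU [hP rP] [hQ rQ]; split; last exact: coef_regular_mul.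
by move=> x Ux; apply: dhomogM; [apply: hP|apply: hQ].
Qed.

Lemma sym_evalM i P Q p :
  sym_eval i (fun x => P x * Q x) p = sym_eval i P p * sym_eval i Q p.
Proof. exact: mevalM. Qed.

Lemma sym_evalD i P Q p :
  sym_eval i (fun x => P x + Q x) p = sym_eval i P p + sym_eval i Q p.
Proof. exact: mevalD. Qed.

Lemma form_coordE i j (p : proj_pt E) : vdom i p.1 -> vdom j p.1 ->
  form_coord j p = form_coord i p *m vtr i j p.1.
Proof.
move=> ip jp; rewrite /form_coord -mulmxA vtr_cocycle //.
exact: vat_dom.
Qed.

(** A change of chart substitutes into Q the linear forms given by the columns of the transition
    matrix. This brings data from two charts into one. *)
Lemma sym_section_chart i j U m Q : zopen U -> U `<=` vdom i -> sym_section U m Q ->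
  exists Q', sym_section (U `&` vdom j) m Q' /\
    forall p, (U `&` vdom j) p.1 -> sym_eval i Q p = sym_eval j Q' p.
Proof.
move=> oU Ui [hQ rQ].
have oUj : zopen (U `&` vdom j) by apply: open_inter => //; apply: vdom_open.
pose F k x : {mpoly C[n]} := \sum_l vtr j i x l k *: 'X_l.
exists (fun x => Q x \mPo [tuple F k x | k < n]); split.
  split=> [x [Ux jx]|].
    apply: homogeneous_comp => [|k]; first exact: hQ.
    rewrite tnth_mktuple; apply: rpred_sum => l _; apply: dhomogZ.
    exact: homogeneousXU.
  apply: (@coef_regular_comp _ _ oUj _ m).
  - by move=> mu; apply: reg_restrict (rQ mu) => // x [].
  - by move=> x [/hQ].
  move=> k; apply: coef_regular_sum => // l; apply: coef_regular_scale => //.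
    by apply: reg_restrict (vtr_regular hE j i l k) => // x [/Ui].
  exact: coef_regular_const.
move=> p [Up jp]; rewrite /sym_eval comp_mpoly_meval; apply: meval_eq => k.
rewrite tnth_mktuple (form_coordE jp (Ui _ Up)) mxE.
rewrite raddf_sum; apply: eq_bigr => l _.
by rewrite /= mevalZ mevalXU mulrC.
Qed.

Lemma proj_open_local W : (forall p, W p -> exists V : set (proj_pt E),
  [/\ proj_open V, V p & V `<=` W]) -> proj_open W.
Proof.
move=> h p /h [V [oV Vp VW]].
have [i [U [m [Q [oU Up sQ Qp QV]]]]] := oV p Vp.
by exists i, U, m, Q; split=> // p' Up' Qp'; apply/VW/QV.
Qed.

Lemma proj_open_inter W W' : proj_open W -> proj_open W' -> proj_open (W `&` W').
Proof.
move=> oW oW' p [Wp W'p].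
have [i [U [m [Q [[oU Ui] Up sQ Qp QV]]]]] := oW p Wp.
have [i' [U' [m' [Q' [[oU' Ui'] Up' sQ' Qp' QV']]]]] := oW' p W'p.
have [Q'' [sQ'' eQ'']] := sym_section_chart i oU' Ui' sQ'.
have oV : zopen (U `&` (U' `&` vdom i)).
  by apply: open_inter => //; apply: open_inter => //; apply: vdom_open.
exists i, (U `&` (U' `&` vdom i)), (m + m')%N, (fun x => Q x * Q'' x); split.
- by split=> // x [/Ui].
- by split=> //; split=> //; apply: Ui.
- by apply: sym_section_mul => //; [apply: sym_section_restrict sQ|
    apply: sym_section_restrict sQ''] => // x [].
- rewrite sym_evalM; apply: mulf_neq0; first exact: Qp.
  rewrite -eQ''; first exact: Qp'.
  by split=> //; apply: Ui.
- move=> p' [Up1 Up2]; rewrite sym_evalM mulf_eq0 negb_or => /andP[h1 h2].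
  split; first exact: QV.
  by apply: QV'; [case: Up2|rewrite eQ''].
Qed.

Lemma proj_open_basic i U m Q : zopen U -> U `<=` vdom i -> sym_section U m Q ->
  proj_open [set p : proj_pt E | U p.1 /\ sym_eval i Q p != 0].
Proof. by move=> oU Ui sQ p [Up Qp]; exists i, U, m, Q. Qed.

Lemma proj_open_preimage U : zopen U -> proj_open [set p : proj_pt E | U p.1].
Proof.
move=> oU p Up; exists (vat E p.1), (U `&` vdom (vat E p.1)), 0%N, (fun=> 1).
have o : zopen (U `&` vdom (vat E p.1)).
  by apply: open_inter => //; apply: vdom_open.
split.
- by split.
- by split=> //; apply: vat_dom.
- by apply: sym_section_const => //; apply: dhomog1.
- by rewrite /sym_eval meval1 oner_neq0.
- by move=> q [].
Qed.

Lemma function_space_proj_bundle : function_space (proj_bundle E).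
Proof.
have main W f g (op : C -> C -> C) : proj_regular W f -> proj_regular W g ->
    (forall i U m m' P P' Q Q', zopen U ->
      @sym_section _ _ E U m P -> @sym_section _ _ E U m Q ->
      @sym_section _ _ E U m' P' -> @sym_section _ _ E U m' Q' ->
      exists P'', @sym_section _ _ E U (m + m') P'' /\ forall p : proj_pt E,
        sym_eval i Q p != 0 -> sym_eval i Q' p != 0 ->
        op (sym_eval i P p / sym_eval i Q p)
           (sym_eval i P' p / sym_eval i Q' p) =
        sym_eval i P'' p / sym_eval i (fun x => Q x * Q' x) p) ->
    proj_regular W (fun x => op (f x) (g x)).
  move=> rf rg h p Wp.
  have [V [i [U [m [P [Q [[oV Vp VW] [oU Ui VU] sP sQ eV]]]]]]] := rf p Wp.
  have [V' [i' [U' [m' [P' [Q' [[oV' Vp' VW'] [oU' Ui' VU'] sP' sQ' eV']]]]]]] :=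
    rg p Wp.
  have [P1 [sP1 eP1]] := sym_section_chart i oU' Ui' sP'.
  have [Q1 [sQ1 eQ1]] := sym_section_chart i oU' Ui' sQ'.
  have oU'i : zopen (U' `&` vdom i) by apply: open_inter => //; apply: vdom_open.
  have oUU : zopen (U `&` (U' `&` vdom i)) by apply: open_inter.
  have := h i _ m m' P P1 Q Q1 oUU
    (sym_section_restrict oUU (@subIsetl _ _ _) sP)
    (sym_section_restrict oUU (@subIsetl _ _ _) sQ)
    (sym_section_restrict oUU (@subIsetr _ _ _) sP1)
    (sym_section_restrict oUU (@subIsetr _ _ _) sQ1).
  move=> [P2 [sP2 eP2]].
  exists (V `&` V'), i, (U `&` (U' `&` vdom i)), (m + m')%N, P2,
    (fun x => Q x * Q1 x); split=> //.
  - split=> //; first exact: proj_open_inter.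
    by move=> q [/VW].
  - split=> //; first by move=> x [/Ui].
    move=> q [Vq V'q]; split; first exact: VU.
    by split; [exact: VU'|exact/Ui/VU].
  - by apply: sym_section_mul => //; [apply: sym_section_restrict sQ|
      apply: sym_section_restrict sQ1] => // x [].
  move=> q [Vq V'q]; have [Qq ->] := eV q Vq; have [Q'q ->] := eV' q V'q.
  have U'q : (U' `&` vdom i) q.1 by split; [exact: VU'|exact/Ui/VU].
  have eQq := eQ1 q U'q; have ePq := eP1 q U'q.
  have Q1q : sym_eval i Q1 q != 0 by rewrite -eQq; exact: Q'q.
  split; last by rewrite ePq eQq; apply: eP2.
  by rewrite sym_evalM; apply: mulf_neq0; [exact: Qq|exact: Q1q].
split=> /=.
- by have := proj_open_preimage (open_full hZ).
- exact: proj_open_inter.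
- exact: proj_open_local.
- move=> W k oW p Wp; pose U := vdom (vat E p.1).
  have oU : zopen U by apply: vdom_open.
  exists (W `&` [set q | U q.1]), (vat E p.1), U, 0%N, (fun=> k%:MP), (fun=> 1).
  split.
  + split; first by apply: proj_open_inter => //; apply: proj_open_preimage.
      by split=> //; apply: vat_dom.
    by move=> q [].
  + by split=> // q [].
  + by apply: sym_section_const => //; apply: homogeneous_const.
  + by apply: sym_section_const => //; apply: dhomog1.
  + by move=> q _; rewrite /sym_eval mevalC meval1 oner_neq0 divr1.
- move=> W f g _ rf rg; apply: main rf rg _.
  move=> i U m m' P P' Q Q' oU sP sQ sP' sQ'.
  exists (fun x => P x * Q' x + P' x * Q x); split.
    apply: sym_section_add => //; first exact: sym_section_mul.
    by rewrite addnC; apply: sym_section_mul.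
  by move=> p Qp Q'p; rewrite sym_evalD !sym_evalM addf_div.
- move=> W f g _ rf rg; apply: main rf rg _.
  move=> i U m m' P P' Q Q' oU sP sQ sP' sQ'.
  exists (fun x => P x * P' x); split; first exact: sym_section_mul.
  by move=> p Qp Q'p; rewrite !sym_evalM mulf_div.
- move=> W f _ rf f0 p Wp.
  have [V [i [U [m [P [Q [[oV Vp VW] hU sP sQ eV]]]]]]] := rf p Wp.
  exists V, i, U, m, Q, P; split=> // q Vq.
  have [Qq fq] := eV q Vq; split; last by rewrite fq invf_div.
  by apply: contraNN (f0 q (VW q Vq)) => /eqP Pq; rewrite fq Pq mul0r.
- move=> W W' f g oW' W'W rf fg p W'p.
  have [V [i [U [m [P [Q [[oV Vp VW] [oU Ui VU] sP sQ eV]]]]]]] :=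
    rf p (W'W p W'p).
  exists (V `&` W'), i, U, m, P, Q; split=> //.
  + by split=> //; apply: proj_open_inter.
  + by split=> // q [/VU].
  + by move=> q [Vq W'q]; rewrite -fg //; apply: eV.
- move=> W f h p Wp; have [W' [oW' W'p rf]] := h p Wp.
  have [V [i [U [m [P [Q [[oV Vp VW] hU sP sQ eV]]]]]]] := rf p (conj Wp W'p).
  by exists V, i, U, m, P, Q; split=> //; split=> // q /VW[].
- move=> W f _ rf; apply: proj_open_local => p [Wp fp].
  have [V [i [U [m [P [Q [[oV Vp VW] [oU Ui VU] sP sQ eV]]]]]]] := rf p Wp.
  exists (V `&` [set q | U q.1 /\ sym_eval i P q != 0]); split.
  + by apply: proj_open_inter => //; apply: proj_open_basic sP.
  + split=> //; split; first exact: VU.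
    have [_ fE] := eV p Vp.
    by apply: contraNN fp => /eqP Pp; rewrite fE Pp mul0r.
  + move=> q [Vq [_ Pq]]; have [Qq fE] := eV q Vq; split; first exact: VW.
    by rewrite fE mulf_neq0 // invr_eq0.
Qed.

Lemma proj_map_morphism : morphism (@proj_map _ _ E).
Proof.
split=> [U oU|U f oU rf]; first exact: proj_open_preimage.
move=> p Up; pose i := vat E p.1.
have oUi : zopen (U `&` vdom i) by apply: open_inter => //; apply: vdom_open.
exists [set q | (U `&` vdom i) q.1], i, (U `&` vdom i), 0%N,
  (fun x => (f x)%:MP), (fun=> 1); split.
- split; first exact: proj_open_preimage.
    by split=> //; apply: vat_dom.
  by move=> q [].
- by split=> // x [].
- by apply: sym_section_fun => //; apply: reg_restrict rf => // x [].
- by apply: sym_section_const => //; apply: dhomog1.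
- by move=> q _; rewrite /sym_eval mevalC meval1 oner_neq0 divr1.
Qed.

Lemma O_proj1_dom_open i k :
  proj_open [set p : proj_pt E | vdom i p.1 /\ form_coord i p 0 k != 0].
Proof.
have oi := vdom_open hE i.
have := proj_open_basic oi (@subset_refl _ _)
  (sym_section_const oi (homogeneousXU k)).
congr proj_open; apply/seteqP.
by split=> p /=; rewrite /sym_eval mevalXU.
Qed.

Lemma is_lbundle_O_proj1 : is_lbundle (O_proj1 E).
Proof.
split=> /=.
- by move=> i; apply: O_proj1_dom_open.
- move=> p; split; first exact: vat_dom.
  rewrite /form_coord (vtr_id hE) ?mulmx1; last exact: vat_dom.
  exact: (xchooseP (hcoord_neq0 p.2)).
- move=> [i k] [j l] /= p [[/= ip ikp] [/= jp jlp]].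
  have oi := vdom_open hE i.
  have oj := vdom_open hE j.
  have [P [sP eP]] := sym_section_chart i oj (@subset_refl _ _)
    (sym_section_const oj (homogeneousXU l)).
  have oji : zopen (vdom j `&` vdom i) by apply: open_inter.
  exists ([set p : proj_pt E | vdom i p.1 /\ form_coord i p 0 k != 0] `&`
    [set p : proj_pt E | vdom j p.1 /\ form_coord j p 0 l != 0]),
    i, (vdom j `&` vdom i), 1%N, P, (fun=> 'X_k); split.
  + split; last exact: subset_refl.
      by apply: proj_open_inter; apply: O_proj1_dom_open.
    by split.
  + by split=> // q [[/= iq _] [/= jq _]].
  + exact: sP.
  + by apply: sym_section_const => //; apply: homogeneousXU.
  move=> q [[/= iq kq] [/= jq lq]]; rewrite -eP //.
  by rewrite /sym_eval !mevalXU.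
- by move=> i p [_ ip]; rewrite divff.
- by move=> i j k p [_ ip] [_ jp] [_ kp]; rewrite mulrC mulrA divfK.
Qed.

End ProjectiveBundle.

(** Twisting keeps the rank, so a point of one bundle is literally a point of the other. In a
    twisted chart a form of degree m is multiplied by the m-th power of a nonzero scalar. The scalar
    need not vary regularly, but it affects neither nonvanishing nor quotients of forms of equal
    degree. *)
Lemma proj_bundle_twist_morphism (Z : Defs.space R) (hZ : function_space Z)
    (E : vbundle Z) (L : lbundle Z) : vector_bundle E -> is_lbundle L ->
  @morphism R (proj_bundle (vtwist E L)) (proj_bundle E)
    (fun p => p : proj_bundle E).
Proof.
move=> hE hL; have [oL aL rL l1 l2] := hL.
have hT := vector_bundle_twist hZ hE hL.
have hPE := function_space_proj_bundle hZ hE.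
have evalE i l m (U : set Z) Q (p : proj_pt E) : @sym_section _ _ E U m Q ->
    U p.1 -> @sym_eval _ _ (vtwist E L) (i, l) Q p =
    ltr (lat L p.1) l p.1 ^+ m * @sym_eval _ _ E i Q p.
  move=> [hQ _] /hQ h; rewrite /sym_eval -(homogeneous_scale _ _ h).
  by apply: meval_eq => k; rewrite /form_coord /= -scalemxAr mxE.
have nz l (p : proj_pt E) m : ldom l p.1 -> ltr (lat L p.1) l p.1 ^+ m != 0.
  by move=> lp; rewrite expf_neq0 // (lbundle_neq0 hL).
have main (W : set (proj_bundle E)) : @proj_open _ _ E W ->
    @proj_open _ _ (vtwist E L) W.
  move=> oW p Wp.
  have [i [U [m [Q [[oU Ui] Up sQ Qp QV]]]]] := oW p Wp.
  have o : zopen (U `&` ldom (lat L p.1)) by apply: open_inter.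
  exists (i, lat L p.1), (U `&` ldom (lat L p.1)), m, Q; split.
  - by split=> // x [/Ui].
  - by split.
  - by have := sym_section_restrict hZ o (@subIsetl _ _ _) sQ.
  - rewrite (evalE _ _ _ _ _ _ sQ Up) mulf_neq0 //; exact: nz.
  - move=> q [Uq lq]; rewrite (evalE _ _ _ _ _ _ sQ Uq) mulf_eq0 negb_or.
    by case/andP=> _; apply: QV.
split=> [|W f oW rf p Wp]; first exact: main.
have [V [i [U [m [P [Q [[oV Vp VW] [oU Ui VU] sP sQ eV]]]]]]] := rf p Wp.
pose l := lat L p.1.
have o : zopen (U `&` ldom l) by apply: open_inter.
exists (V `&` [set q | ldom l q.1]), (i, l), (U `&` ldom l), m, P, Q; split.
- split; last by move=> q [/VW].
    apply: main; apply: proj_open_inter => //; exact: proj_open_preimage.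
  by split=> //; apply: aL.
- split=> //; first by move=> x [/Ui].
  by move=> q [/VU].
- by have := sym_section_restrict hZ o (@subIsetl _ _ _) sP.
- by have := sym_section_restrict hZ o (@subIsetl _ _ _) sQ.
move=> q [Vq lq]; have [Qq fq] := eV q Vq; have Uq := VU q Vq.
rewrite (evalE _ _ _ _ _ _ sQ Uq) (evalE _ _ _ _ _ _ sP Uq).
rewrite mulf_neq0 //; last exact: nz.
by split=> //; rewrite -mulf_div divff ?mul1r //; apply: nz.
Qed.

End VectorBundles.

(** * The degree inequality along a chain of maps *)

Section CurveInequality.
Context {R : realType}.
Local Notation C := R[i].

Definition lhom_at (Z : Defs.space R) (L M : lbundle Z) (z : Z) : Prop :=
  exists u, @lhom R Z L M u /\
    exists i j, [/\ ldom i z, ldom j z & u i j z != 0].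

(** The k-th power of the first map and the m-th power of the second compose through P^(mk) to a map
    H^(qm) -> L^(mk), nonzero because both are nonzero at the same point z; the factor m then
    cancels. *)
Lemma degree_le_lhom_at (Z : Defs.space R) (L P H : lbundle Z) z m k q u v :
  function_space Z -> irreducible_space Z ->
  is_lbundle L -> is_lbundle P -> is_lbundle H -> (0 < m)%N -> (0 < k)%N ->
  lhom_at (lpower L m) (lpower P m) z -> lhom_at (lpower P k) (lpower H q) z ->
  degree L u -> degree H v -> q%:Z * v <= k%:Z * u.
Proof.
move=> hZ irr hL hP hH m0 k0 [s [hs [i [j [iz jz sz]]]]].
move=> [t [ht [j' [l [j'z lz tz]]]]] du dv.
have pw K a := @is_lbundle_power _ _ hZ K a.
have hs' := lhom_power hZ k (pw L m hL) (pw P m hP) hs.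
have ht' := lhom_power hZ m (pw P k hP) (pw H q hH) ht.
have hsk : @lhom _ Z (lpower L (m * k)) (lpower P (m * k))
    (fun i j x => s i j x ^+ k).
  split=> [i1 j1|i1 i2 j1 j2 x h1 h2 h3 h4]; first exact: hs'.1.
  by rewrite /= !exprM; apply: hs'.2.
have htm : @lhom _ Z (lpower P (m * k)) (lpower H (q * m))
    (fun i j x => t i j x ^+ m).
  split=> [i1 j1|i1 i2 j1 j2 x h1 h2 h3 h4]; first exact: ht'.1.
  by rewrite /= exprM mulnC exprM; apply: ht'.2.
have hc := lhom_comp hZ (pw L _ hL) (pw P _ hP) (pw H _ hH) hsk htm.
have [P0 eP0] : exists P0, (m * k)%N = P0.+1.
  by exists (m * k).-1; rewrite prednK // muln_gt0 m0.
rewrite eP0 in hc.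
have aP : ldom (lat P z) z by case: hP.
have := degree_le_lhom hZ irr hL hH hc _ du dv; rewrite -eP0.
have -> : (q * m)%:Z * v = m%:Z * (q%:Z * v) by rewrite PoszM; ring.
rewrite PoszM -mulrA ler_pM2l //; apply.
exists i, l, z; split=> //; apply: mulf_neq0; apply: expf_neq0.
  by apply: (lhom_neq0 hs (pw P m hP) iz iz jz aP sz).
by apply: (lhom_neq0 ht (pw H q hH) j'z aP lz lz tz).
Qed.

Lemma irreducible_subspace (Z : Defs.space R) (A : set Z) :
  irreducible_closed A -> irreducible_space (subspace A).
Proof.
move=> [A0 _ h] _ _ [U [oU ->]] [V [oV ->]] [x Ux] [y Vy].
apply: contrapT => UV0.
have cl (W : set Z) : zopen W -> zclosed (~` W) by rewrite /zclosed setCK.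
have [] := h _ _ (cl U oU) (cl V oV).
- move=> z Az; have [Uz|] := pselect (U z); last by left.
  by right=> Vz; apply: UV0; exists (exist _ z Az).
- by move=> /(_ (sval x) (svalP x)); apply.
- by move=> /(_ (sval y) (svalP y)); apply.
Qed.

(** * Morphisms to projective space described by forms *)

Section MapToProjectiveSpace.
Variables (N M : nat) (B : set (proj_space N : Defs.space R)).
Local Notation X := (subspace B).
Variables (f : X -> proj_space M) (hf : morphism f).
Local Notation xcoord z := (sval z : @lines R N.+1).
Local Notation ycoord z := (hcoord (f z : @lines R M.+1)).

(* The equality f = [G_0 : ... : G_M] on {q <> 0}, cross-multiplied since the  *)
(* G_j may vanish simultaneously.                                             *)
Definition given_by_forms (q : {mpoly C[N.+1]}) (e : nat)
    (G : 'I_M.+1 -> {mpoly C[N.+1]}) : Prop :=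
  [/\ exists d, homogeneous d q, forall j, homogeneous e (G j) &
      forall z : X, heval q (xcoord z) != 0 -> forall j j',
        heval (G j) (xcoord z) * ycoord z 0 j' =
        heval (G j') (xcoord z) * ycoord z 0 j].

(** Near x some coordinate j0 of f is nonzero and each ratio of coordinates to it is a fraction of
    forms. G_j is the numerator for j times the denominators for the other indices: all G_j have one
    degree, and G_j is the j-th ratio times a common nonvanishing factor. *)
Lemma locally_given_by_forms (x : X) :
  exists q e G, [/\ heval q (xcoord x) != 0, given_by_forms q e G &
    forall z : X, heval q (xcoord z) != 0 ->
      exists j, heval (G j) (xcoord z) != 0].
Proof.
pose j0 := some_coord (f x : @lines R M.+1).
have fj0 : ycoord x 0 j0 != 0 by apply: (xchooseP (hcoord_neq0 (f x))).
pose V0 := [set y : @lines R M.+1 | hcoord y 0 j0 != 0].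
have oV0 : zopen (V0 : set (proj_space M)) by apply: hcoord_open.
have [W0 [/proj_space_openP oW0 eW0]] := hf.1 _ oV0.
have W0x : W0 (sval x) by have : (f @^-1` V0) x by []; rewrite eW0.
have [r0 [e0 [hr0 r0x r0W]]] := oW0 _ W0x.
have loc j : exists g : nat * nat *
    ({mpoly C[N.+1]} * {mpoly C[N.+1]} * {mpoly C[N.+1]}),
    [/\ homogeneous g.1.1 g.2.1.1 /\ heval g.2.1.1 (xcoord x) != 0,
        homogeneous g.1.2 g.2.1.2, homogeneous g.1.2 g.2.2 &
        forall z : X, heval g.2.1.1 (xcoord z) != 0 -> V0 (f z) ->
          heval g.2.2 (xcoord z) != 0 /\ ycoord z 0 j / ycoord z 0 j0 =
          heval g.2.1.2 (xcoord z) / heval g.2.2 (xcoord z)].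
  have rj : regular (V0 : set (proj_space M)) _ :=
    hcoord_ratio_regular j oV0 (fun x h => h).
  have [W [h [oW Wx /proj_space_regularP rh eh]]] := hf.2 _ _ oV0 rj x fj0.
  have [r [e [d [p [q [hr rx hp hq epq]]]]]] := rh _ Wx.
  exists (e, d, (r, p, q)); split=> //= z rz Vz.
  have [Wz qz hz] := epq _ rz; split=> //.
  by rewrite -hz -eh.
have /choice[g hg] := loc.
pose q := r0 * \prod_j (g j).2.1.1.
have qP z : heval q (xcoord z) != 0 ->
    V0 (f z) /\ forall j, heval (g j).2.1.1 (xcoord z) != 0.
  rewrite hevalM heval_prod mulf_eq0 negb_or => /andP[r0z].
  rewrite prodf_seq_neq0 => /allP pz; split.
    have : (f @^-1` V0) z by rewrite eW0; apply: r0W.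
    by [].
  by move=> j; apply: pz; rewrite mem_index_enum.
pose G j := \prod_j' (if j' == j then (g j').2.1.2 else (g j').2.2).
have GE z j : heval q (xcoord z) != 0 -> heval (G j) (xcoord z) =
    ycoord z 0 j / ycoord z 0 j0 * \prod_j' heval (g j').2.2 (xcoord z).
  move=> /qP[Vz gz]; rewrite heval_prod (bigD1 j) //= eqxx.
  rewrite [in RHS](bigD1 j) //= mulrA; have [_ _ _ h] := hg j.
  have [g2 ->] := h z (gz j) Vz; rewrite divfK //; congr (_ * _).
  by apply: eq_bigr => j' /negPf ->.
exists q, (\sum_j (g j).1.2)%N, G; split.
- rewrite hevalM heval_prod mulf_neq0 //; apply/prodf_neq0 => j _.
  by have [[]] := hg j.
- split.
  + exists (e0 + \sum_j (g j).1.1)%N; apply: dhomogM => //.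
    by apply: homogeneous_prod => j; have [[]] := hg j.
  + move=> j; apply: homogeneous_prod => j'.
    by have [_ h1 h2 _] := hg j'; case: ifP.
  + by move=> z qz j j'; rewrite !GE //; ring.
- move=> z qz; exists j0; have [Vz gz] := qP z qz.
  rewrite GE // divff // mul1r; apply/prodf_neq0 => j _.
  by have [_ _ _ h] := hg j; have [] := h z (gz j) Vz.
Qed.

(** By [common_zeros_finite], finitely many local descriptions cover X. Each is brought to a common
    degree by a power of a coordinate that is nonzero at x; this may create common zeros elsewhere,
    so nonvanishing is claimed at x only. *)
Lemma given_by_forms_bounded : exists2 k, (0 < k)%N & forall x : X,
  exists q G, [/\ heval q (xcoord x) != 0, given_by_forms q k G &
    exists j, heval (G j) (xcoord x) != 0].
Proof.
pose S := [set q : {mpoly C[N.+1]} | exists eG, given_by_forms q eG.1 eG.2 /\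
  forall z : X, heval q (xcoord z) != 0 ->
    exists j, heval (eG.2 j) (xcoord z) != 0].
have [l [lS hl]] := common_zeros_finite S.
have /choice[e he] : forall q : {mpoly C[N.+1]}, exists eG, q \in l ->
    given_by_forms q eG.1 eG.2 /\ forall z : X, heval q (xcoord z) != 0 ->
    exists j, heval (eG.2 j) (xcoord z) != 0.
  move=> q; have [/lS[eG h]|ql] := boolP (q \in l); first by exists eG.
  by exists (0%N, fun=> 0).
(* The sum bounds every degree in l, and the successor makes k positive, so that m0 / k makes sense
   later. *)
pose k := (\sum_(q <- l) (e q).1).+1.
exists k => // x.
have [q ql qx] : exists2 q, q \in l & heval q (xcoord x) != 0.
  apply: contrapT => h; have [q [i [G [qx gG nG]]]] := locally_given_by_forms x.
  move/eqP: qx; apply; apply: (hl (fun k => hcoord (xcoord x) 0 k)).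
    by move=> q' q'l; apply/eqP/negPn/negP => q'x; apply: h; exists q'.
  by exists (i, G).
have [[hq hG rel] nG] := he q ql.
have ek : ((e q).1 <= k)%N.
  rewrite /k (big_rem q) //=; apply: leqW; exact: leq_addr.
pose b := some_coord (xcoord x).
have xb : hcoord (xcoord x) 0 b != 0 by apply: (xchooseP (hcoord_neq0 _)).
exists q, (fun j => (e q).2 j * 'X_b ^+ (k - (e q).1)); split=> //.
  split=> // [j|z qz j j'].
    rewrite -[k in homogeneous k](subnKC ek); apply: dhomogM; first exact: hG.
    by rewrite -[X in X.-homog]mul1n; apply: homogeneousX; apply: homogeneousXU.
  by rewrite !hevalM mulrAC rel // mulrAC.
have [j Gj] := nG x qx; exists j.
by rewrite hevalM hevalX hevalXU mulf_neq0 // expf_neq0.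
Qed.

(** The map is multiplication by G_l / y_l, which does not depend on l. In the charts i and l it is
    G_l / x_i^k, which has no pole on {x_i <> 0}, so it is defined on all of Y. *)
Lemma lhom_at_given_by_forms (Y : Defs.space R) (g : Y -> X) (y : Y) k q G :
  function_space Y -> irreducible_space Y -> morphism g ->
  heval q (xcoord (g y)) != 0 -> given_by_forms q k G ->
  (exists j, heval (G j) (xcoord (g y)) != 0) ->
  lhom_at (lpower (lpullback (@Defs.incl R _ B \o g) (O_P N 1)) k)
    (lpullback (f \o g) (O_P M 1)) y.
Proof.
move=> hY irr hg qy [[dq hq] hG rel] [j Gj].
have hx : morphism (@Defs.incl R _ B \o g).
  exact: comp_morphism hg (incl_morphism B).
have hfg := comp_morphism hg hf.
pose x (z : Y) : 'rV[C]_N.+1 := hcoord (xcoord (g z)).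
pose y' (z : Y) : 'rV[C]_M.+1 := ycoord (g z).
have oX i : zopen [set z | x z 0 i != 0] := hx.1 _ (hcoord_open i).
have oY i : zopen [set z | y' z 0 i != 0] := hfg.1 _ (hcoord_open i).
have rG i l : regular [set z | x z 0 i != 0]
    (fun z => heval (G l) (xcoord (g z)) / x z 0 i ^+ k).
  have hXi := homogeneousX k (homogeneousXU (R := R) i); rewrite mul1n in hXi.
  have nz (z : @lines R N.+1) : hcoord z 0 i != 0 -> heval ('X_i ^+ k) z != 0.
    by rewrite hevalX hevalXU; apply: expf_neq0.
  have := hx.2 _ _ (hcoord_open i)
    (fraction_regular (hcoord_open i) (hG l) hXi nz).
  by move/(reg_ext hY (oX i)); apply=> z _; rewrite /= hevalX hevalXU.
(* The relation extends from the nonempty open set {q <> 0} by density. *)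
have relY z i l : y' z 0 i != 0 ->
    heval (G i) (xcoord (g z)) * y' z 0 l = heval (G l) (xcoord (g z)) * y' z 0 i.
  move=> yi; pose b := some_coord (xcoord (g z)).
  have xb : x z 0 b != 0 by apply: (xchooseP (hcoord_neq0 _)).
  pose U := [set z | x z 0 b != 0] `&` [set z | y' z 0 i != 0].
  have oU : zopen U by apply: open_inter.
  pose h z := heval (G i) (xcoord (g z)) / x z 0 b ^+ k * (y' z 0 l / y' z 0 i)
    - heval (G l) (xcoord (g z)) / x z 0 b ^+ k.
  have rh : regular U h.
    apply: reg_subr => //; last by apply: reg_restrict (rG b l) => // ? [].
    apply: reg_mul => //; first by apply: reg_restrict (rG b i) => // ? [].
    have ry : regular _ _ := hfg.2 _ _ (hcoord_open i)
      (hcoord_ratio_regular l (hcoord_open i) (fun x h => h)).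
    by apply: reg_restrict ry => // ? [].
  have hE t : U t -> h t = (heval (G i) (xcoord (g t)) * y' t 0 l
      - heval (G l) (xcoord (g t)) * y' t 0 i) / (x t 0 b ^+ k * y' t 0 i).
    move=> [/= tb ti]; rewrite /h.
    by field; rewrite ti expf_neq0.
  have Uz : U z by [].
  apply/eqP; rewrite -subr_eq0; apply: contrapT => /negP nz.
  have [t [[Ut ht] qt]] : ([set z | U z /\ h z != 0] `&`
      [set z | heval q (xcoord (g z)) != 0]) !=set0.
    apply: irr; [exact: open_neq0|exact: (hx.1 _ (basic_open hq))| |by exists y].
    exists z; split=> //; rewrite hE // mulf_neq0 // invr_eq0 mulf_neq0 //.
    exact: expf_neq0.
  by move: ht; rewrite hE // (rel _ qt i l) subrr mul0r eqxx.
exists (fun i l z => heval (G l) (xcoord (g z)) / x z 0 i ^+ k); split.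
  split=> [i l|i i' l l' z /= xi xi' yl yl'].
    have o := open_inter hY (oX i) (oY l).
    by apply: (reg_restrict hY o (@subIsetl _ _ _) (rG i l)).
  have := relY z l l' yl; rewrite -!/(x z) -!/(y' z) !expr1z expr_div_n => e.
  transitivity (heval (G l) (xcoord (g z)) * y' z 0 l' / (x z 0 i ^+ k * y' z 0 l)).
    by field; rewrite yl expf_neq0.
  by rewrite e; field; rewrite yl !expf_neq0.
exists (some_coord (xcoord (g y))), (some_coord (f (g y) : @lines R M.+1)).
have xy : x y 0 (some_coord (xcoord (g y))) != 0.
  exact: (xchooseP (hcoord_neq0 _)).
have yy : y' y 0 (some_coord (f (g y) : @lines R M.+1)) != 0.
  exact: (xchooseP (hcoord_neq0 _)).
split=> //; apply: mulf_neq0; last by rewrite invr_eq0 expf_neq0.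
(* If the form at a nonzero coordinate of f(g(y)) vanished there, the relation would make G_j vanish
   too. *)
apply: contraNN Gj => /eqP G0; have := relY y _ j yy; rewrite G0 mul0r.
by move=> /esym/eqP; rewrite mulf_eq0 (negPf yy) orbF.
Qed.

End MapToProjectiveSpace.

(** The k-th power of a coordinate that is nonzero at y, seen as a map from the trivial bundle H^0
    to O(k). It serves to prove 0 <= u. *)
Lemma lhom_at_O_P (N : nat) (Y : Defs.space R) (x : Y -> proj_space N)
    (H : lbundle Y) y k :
  function_space Y -> morphism x -> is_lbundle H ->
  lhom_at (lpower (lpullback x (O_P N 1)) k) (lpower H 0) y.
Proof.
move=> hY hx [oH aH _ _ _]; pose b := some_coord (x y : @lines R N.+1).
pose X z : 'rV[C]_N.+1 := hcoord (x z : @lines R N.+1).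
have xb : X y 0 b != 0 by apply: (xchooseP (hcoord_neq0 _)).
exists (fun i _ z => (X z 0 b / X z 0 i) ^+ k); split; last first.
  exists b, (lat H y); split; [exact: xb|exact: aH|].
  by rewrite divff // expr1n oner_neq0.
split=> [i j|i i' j j' z /= xi xi' _ _].
  have oi : zopen [set z | X z 0 i != 0] := hx.1 _ (hcoord_open i).
  have ri : regular _ _ := hx.2 _ _ (hcoord_open i)
    (hcoord_ratio_regular b (hcoord_open i) (fun x h => h)).
  have o := open_inter hY oi (oH j).
  exact: (reg_restrict hY o (@subIsetl _ _ _) (reg_exp hY k oi ri)).
rewrite expr0 mulr1 -exprMn expr1z ; congr (_ ^+ _).
rewrite -[hcoord (x z)]/(X z) in xi xi' *.
by field; rewrite xi xi'.
Qed.

End CurveInequality.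

(** * From sections on P(Om) to maps on P(Om(-a)) *)

Section CotangentTwist.
Context {R : realType}.
Local Notation C := R[i].

(* Since P(Om(-a)) = P(Om) with O(1) twisted by O(-a), a section of           *)
(* O_P(Om)(1)(-a-1)^m is a map from O_X(m) to O_P(Om(-a))(m).                 *)
Lemma lhom_at_section (N : nat) (B : set (proj_space N : Defs.space R))
    (Om : vbundle (subspace B)) (a m : nat) s (p : proj_pt Om) :
  let O k := lrestrict B (O_P N k) in
  let L := ltensor (O_proj1 Om) (lpullback (@proj_map R _ Om) (O (- a.+1%:Z))) in
  let E := vtwist Om (O (- a%:Z)) in
  vector_bundle Om ->
  @is_section R _ (lpower L m) setT s -> s (lat L p) p != 0 ->
  lhom_at (lpower (O_proj1 E) m)
    (lpower (lpullback (@proj_map R _ E) (O 1)) m) p.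
Proof.
move=> O L E hOm [rs ts] sp.
have hP := @function_space_proj_space R N.
have hX := function_space_subspace B hP.
have hO k : is_lbundle (O k).
  by apply: is_lbundle_pullback (is_lbundle_O_P k) => //; apply: incl_morphism.
have hE := vector_bundle_twist hX hOm (hO (- a%:Z)).
have hPE := function_space_proj_bundle hX hE.
have lE := is_lbundle_O_proj1 hX hE.
have lO := is_lbundle_pullback hX (proj_map_morphism hX hE) (hO 1).
have lOm := is_lbundle_O_proj1 hX hOm.
have hid := proj_bundle_twist_morphism hX hOm (hO (- a%:Z)).
pose x (q : proj_pt Om) : 'rV[C]_N.+1 := hcoord (sval q.1 : @lines R N.+1).
pose lam (l : 'I_N.+1) (q : proj_pt Om) : C :=
  ltr (l := O (- a%:Z)) (lat (O (- a%:Z)) q.1) l q.1.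
have formE i l k (q : proj_pt Om) : @form_coord R _ E (i, l) q 0 k =
    lam l q * @form_coord R _ Om i q 0 k.
  by rewrite /form_coord /= -scalemxAr mxE.
have xb (q : proj_pt Om) : x q 0 (lat (O 1) q.1) != 0.
  by have [_ + _ _ _] := hO 1; apply.
have lam0 l (q : proj_pt Om) : x q 0 l != 0 -> lam l q != 0.
  by move=> xl; apply: (lbundle_neq0 (hO _)) => //; apply: xb.
have domE i l k (q : proj_pt Om) : ldom (l := O_proj1 E) (i, l, k) q ->
    [/\ x q 0 l != 0, vdom i q.1 & @form_coord R _ Om i q 0 k != 0].
  move=> [[iq lq]]; rewrite formE mulf_eq0 negb_or => /andP[_ kq].
  by split.
(* In a chart with index l, s lacks a twist by O(m) to be a section of O_P(E)(m); the transition
   function of O(m) from l to j supplies it. *)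
pose tau (I : lidx (O_proj1 E)) (j : 'I_N.+1) (q : proj_pt Om) : C :=
  s ((I.1.1, I.2), I.1.2) q *
  ltr (l := O 1) I.1.2 j q.1 ^+ m.
have [oE _ _ _ _] := lE; have [oO _ rO _ _] := lO; have [oOm _ _ _ _] := lOm.
have hh : lhom (L := lpower (O_proj1 E) m)
    (M := lpower (lpullback (@proj_map R _ E) (O 1)) m) tau.
  split=> [[[i l] k] j|[[i l] k] [[i' l'] k'] j j' q /domE[xl iq kq]
                       /domE[xl' iq' kq']].
    have o := open_inter hPE (oE (i, l, k)) (oO j).
    apply: (reg_mul hPE o).
      have oL : zopen (setT `&` ldom (l := lpower L m) ((i, k), l)).
        have hPO := function_space_proj_bundle hX hOm.
        apply: (open_inter hPO (open_full hPO)).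
        apply: (open_inter hPO (oOm (i, k))).
        have [oOa _ _ _ _] := hO (- a.+1%:Z).
        exact: ((proj_map_morphism hX hOm).1 _ (oOa l)).
      (* s is regular on P(Om) and is transported to P(E) by the identity. *)
      have := hid.2 _ _ oL (rs ((i, k), l)).
      by apply: (reg_restrict hPE o) => q [/domE[xl iq kq] _].
    apply: (reg_exp hPE m o).
    by apply: (reg_restrict hPE o _ (rO l j)) => q [/domE[xl iq kq] xj].
  move=> /= xj xj'; rewrite /tau /=.
  have -> := ts ((i, k), l) ((i', k'), l') q I (conj (conj iq kq) xl)
    (conj (conj iq' kq') xl').
  rewrite /= !formE -/(x q).
  have lamE : lam l' q = lam l q * (x q 0 l' / x q 0 l) ^ (- a%:Z).
    have [_ _ _ _ h] := hO (- a%:Z).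
    by rewrite /lam -(h _ l l' q.1) //; apply: xb.
  have rE (r : C) : r != 0 -> r ^ (- a.+1%:Z) = r ^ (- a%:Z) / r.
    by move=> r0; rewrite -addn1 PoszD opprD expfzDr // exprN1.
  rewrite rE; last by rewrite mulf_neq0 // invr_eq0.
  rewrite lamE !expr1z; have := lam0 l q xl.
  move: (lam l q) ((x q 0 l' / x q 0 l) ^ (- a%:Z)) => w t w0.
  move: (@form_coord R _ Om i q 0 k) (@form_coord R _ Om i' q 0 k') kq kq'.
  move=> y y' y0 y'0.
  have pw (b1 b2 b3 c1 c2 S : C) : b1 * b2 * b3 = c1 * c2 ->
      b1 ^+ m * S * b2 ^+ m * b3 ^+ m = c1 ^+ m * (S * c2 ^+ m).
    by move=> e; rewrite [RHS]mulrCA -exprMn -e !exprMn; ring.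
  apply: pw; move: xl xl' xj xj'; rewrite -/(x q) => xl xl' xj xj'.
  field.
  by rewrite xl xl' y0 w0 xj.
exists tau; split=> //.
have [_ aE _ _ _] := lE; have [_ aO _ h1 _] := lO.
exists (lat (O_proj1 E) p), (lat (O 1) p.1); split; [exact: aE|exact: aO|].
apply: mulf_neq0; first exact: sp.
have [_ aX _ _ _] := hO 1.
by apply: expf_neq0; apply: (lbundle_neq0 (hO 1) (aX p.1) (aX p.1)).
Qed.

End CotangentTwist.

(** * The bound on epsilon and the contradiction on a curve *)

Theorem corollary4p7 (R : realType) (N n c a delta : nat)
    (hN : (1 <= N)%N) (hn : (1 <= n)%N) (hc : (1 <= c)%N)
    (hNnc : N = (n + c)%N)
    (hdelta : is_delta R N n a.+1 delta)
    (hcn : (n <= c)%N)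
    (d : 'I_c -> nat) (hd : forall i, (delta <= d i)%N) :
  generic_ci n d (fun F : 'I_c -> {mpoly R[i][N.+1]} =>
    exists T : set (ci F),
      [/\ zclosed T, codim_ge T 2 &
          ample_modulo (vtwist (cotangent n (ci F)) (O_ci F (- a%:Z))) T]).
Proof.
have [U [oU U0 hU]] := hdelta.2 c d hNnc hcn hd.
exists U; split=> // F eF UF.
have [sF [_ [Y [cY dY hY]]]] := hU F eF UF; split=> //.
exists Y; split=> // H lH [m0 m0_gt0 [M [f [/closed_embedding_morphism hf iH]]]].
(* k is fixed before the curve, so that the bound m0 / k on eps is uniform. *)
have [k k_gt0 hk] := given_by_forms_bounded hf.
have hX := function_space_subspace (zero_locus F) (@function_space_proj_space R N).
have hOm : vector_bundle (cotangent n (ci F)).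
  by apply: vector_bundle_cotangent => //; case: sF.
have hO j : is_lbundle (O_ci F j).
  by apply: is_lbundle_pullback (is_lbundle_O_P j);
    [exact: function_space_proj_space|exact: incl_morphism].
set E := vtwist _ _.
have hE : vector_bundle E by apply: vector_bundle_twist.
have hPE := function_space_proj_bundle hX hE.
have hpi := proj_map_morphism hX hE.
have m0R : 0 < m0%:R :> R by rewrite ltr0n.
have kR : 0 < k%:R :> R by rewrite ltr0n.
exists (m0%:R / k%:R); first exact: divr_gt0.
move=> eps eps0 epsk A u v [iA _] hu hv uv _ [p Ap <-].
apply: contrapT => pY.
pose Om := cotangent n (ci F).
pose L := ltensor (O_proj1 Om) (lpullback (@proj_map R _ Om) (O_ci F (- a.+1%:Z))).
(* Read as a point of P(Om), p lies outside the stable base locus because its image is not in Y. *)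
have [m [s [m_gt0 hs sp]]] : exists m (s : lidx (lpower L m) -> _ -> R[i]),
    [/\ (0 < m)%N, is_section setT s & s (lat L p) p != 0].
  apply: contrapT => h; apply: pY.
  apply: (hY p.1); exists (p : proj_bundle Om) => // m s m_gt0 hs.
  by apply/eqP/negPn/negP => sp; apply: h; exists m, s.
have hA := function_space_subspace A hPE.
have irr := irreducible_subspace iA.
pose g : subspace A -> ci F := @proj_map _ _ E \o @Defs.incl R _ A.
have hg : morphism g := comp_morphism (incl_morphism A) hpi.
pose y : subspace A := exist _ p Ap.
pose L1 := lrestrict A (O_proj1 E).
pose P1 := lpullback g (O_ci F 1).
pose H1 := lpullback g H.
have lL : is_lbundle L1.
  by apply: is_lbundle_pullback (is_lbundle_O_proj1 hX hE) => //;
    apply: incl_morphism.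
have lP : is_lbundle P1 by apply: is_lbundle_pullback (hO 1).
have lH1 : is_lbundle H1 by apply: is_lbundle_pullback lH.
have hLP : lhom_at (lpower L1 m) (lpower P1 m) y.
  have [w [hw [i [j [ip jp wp]]]]] := lhom_at_section hOm hs sp.
  exists (fun i j z => w i j (Defs.incl z)); split; last by exists i, j.
  apply: (lhom_pullback hPE (incl_morphism A) _ _ hw).
    exact: (is_lbundle_power hPE m (is_lbundle_O_proj1 hX hE)).
  apply: (is_lbundle_power hPE m).
  exact: (is_lbundle_pullback hX hpi (hO 1)).
have hPH0 : lhom_at (lpower P1 k) (lpower H1 0) y.
  have hx : morphism (@Defs.incl R _ (zero_locus F) \o g).
    exact: comp_morphism hg (incl_morphism _).
  exact: (lhom_at_O_P y k hA hx lH1).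
have hPH : lhom_at (lpower P1 k) (lpower H1 m0) y.
  have [q [G [qy hG Gy]]] := hk (g y).
  have [w [hw [i [j [iy jy wy]]]]] := lhom_at_given_by_forms hf hA irr hg qy hG Gy.
  have [t [rt t0 ht]] := iH.
  have [oH aH _ _ _] := lH.
  have lM : is_lbundle (lpullback f (O_P M 1)).
    apply: is_lbundle_pullback hf (is_lbundle_O_P 1).
    exact: function_space_proj_space.
  have [oM _ _ _ _] := lM.
  (* [iH] gives a map from the pullback of O(1) to H^m0; composing with [hw] needs the opposite
     direction, hence the inverses. *)
  have ht' : lhom (L := lpullback f (O_P M 1)) (M := lpower H m0)
      (fun j i x => (t i j x)^-1).
    split=> [j1 i1|j1 j2 i1 i2 x j1x j2x i1x i2x].
      apply: (reg_inv hX); first exact: (open_inter hX (oM j1) (oH i1)).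
        by rewrite setIC; apply: rt.
      by move=> x [j1x i1x]; apply: t0.
    have := ht i1 i2 j1 j2 x i1x i2x j1x j2x.
    have := t0 i1 j1 x i1x j1x; have := t0 i2 j2 x i2x j2x.
    move: (t i1 j1 x) (t i2 j2 x) => b1 b2 b20 b10 e.
    by apply: (mulfI b10); rewrite mulVKf // mulrA e mulfK.
  have ht2 := lhom_pullback hX hg lM (is_lbundle_power hX m0 lH) ht'.
  have lM' := is_lbundle_pullback hX hg lM.
  have hcomp := lhom_comp hA (is_lbundle_power hA k lP) lM'
    (is_lbundle_power hA m0 lH1) hw ht2.
  eexists; split; first exact: hcomp.
  have [_ aM _ _ _] := lM'.
  exists i, (lat H (g y)); split; [exact: iy|exact: aH|].
  apply: mulf_neq0; first exact: (lhom_neq0 hw lM' iy iy jy (aM y) wy).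
  by rewrite invr_eq0; apply: t0; [exact: aH|exact: (aM y)].
have le0 := degree_le_lhom_at hA irr lL lP lH1 m_gt0 k_gt0 hLP hPH0 hu hv.
have lem := degree_le_lhom_at hA irr lL lP lH1 m_gt0 k_gt0 hLP hPH hu hv.
have u0 : 0 <= u%:~R :> R.
  by rewrite ler0z; move: le0; rewrite mul0r pmulr_rge0.
have {}lem : m0%:R * v%:~R <= k%:R * u%:~R :> R.
  by rewrite -[m0%:R]/(m0%:~R) -[k%:R]/(k%:~R) -!intrM ler_int.
(* If v <= 0, then u < eps v <= 0 contradicts 0 <= u; otherwise u < eps v < (m0 / k) v contradicts
   m0 v <= k u. *)
have [v0|v0] := lerP (v%:~R : R) 0.
  have : eps * v%:~R <= 0 by rewrite pmulr_rle0.
  by move=> /(lt_le_trans uv); rewrite ltNge u0.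
have : k%:R * u%:~R < m0%:R * v%:~R :> R.
  rewrite mulrC -ltr_pdivlMr //; apply: lt_trans uv _.
  by rewrite mulrAC ltr_pM2r.
by rewrite ltNge lem.
Qed.
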